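(* Let $T=(1,3,4^k,3,1)$ with $k\ge 3$. There are exactly $26$ potential Jordan degree types for pairs $(A,\ell)$ with $A\in\mathrm{Gor}(T)$ and $\ell\in A_1$; equivalently, there are exactly $26$ potential rank matrices for $T$.
   Context: $\mathsf{k}$ is an infinite field of arbitrary characteristic, $R=\mathsf{k}[x,y,z]$ with the standard grading; $4^k$ means $4$ repeated $k$ times. $\mathrm{Gor}(T)$ is the family of graded Artinian Gorenstein (AG) quotients $A=R/I$ with Hilbert function $T=(t_0,\dots,t_j)$; $j$ is the socle degree and $s=\max_i t_i$. For a nonzero linear form $\ell\in A_1$, the rank matrix $M_{A,\ell}$ is the $(j+1)\times(j+1)$ upper triangular matrix (indices $0,\dots,j$) with $(u,v)$ entry, $u\le v$, the rank of $\ell^{v-u}:A_u\to A_v$. A potential rank matrix for $T$ is an upper triangular $(j+1)\times(j+1)$ matrix $M$ of non-negative integers, with rows and columns indexed by $0,\dots,j$, satisfying the known necessary conditions for rank matrices: (i) writing $H(i)=(M_{0,i},M_{1,i+1},\dots,M_{j-i,j})$ for the $i$-th diagonal, $H(0)=T$, $H(1)\ne 0$, and each $H(i)$ is either zero or the Hilbert function of a graded AG quotient of $R$ of socle degree $j-i$; (ii) each difference $H(i)-(0,H(i+1))$ is an O-sequence, i.e. zero or the Hilbert function of a standard graded algebra; (iii) in the upper triangular part, rows are non-increasing from left to right and columns are non-decreasing from top to bottom; (iv) $M_{u+1,v}+M_{u,v+1}\ge M_{u,v}+M_{u+1,v+1}$ whenever $0\le u<v<j$; (v) for all $u\le v$ with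 $t_u=t_v=s$, the entry $M_{u,v}$ depends only on $v-u$. The potential Jordan degree type associated with $M$ is the multiset of pairs $(p,\nu)$ (strings of length $p$ starting in degree $\nu$) in which $(v-u+1,u)$ has multiplicity $M_{u,v}+M_{u-1,v+1}-M_{u-1,v}-M_{u,v+1}$ for $0\le u\le v\le j$ (entries with indices out of range being $0$). This correspondence between potential rank matrices and potential Jordan degree types is one-to-one; for $M=M_{A,\ell}$ it gives the actual Jordan degree type of $(A,\ell)$, i.e. the lengths and initial degrees of the strings in a decomposition of $A$ into graded cyclic $\mathsf{k}[\ell]$-modules. *)

(* Defs.v *)
From HB Require Import structures.
From mathcomp Require Import all_boot all_order all_algebra.
From mathcomp Require Import finmap multiset.
From mathcomp.multinomials Require Import mpoly.

Set Implicit Arguments.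
Unset Strict Implicit.
Unset Printing Implicit Defensive.

Import Order.TTheory GRing.Theory Num.Theory.
Local Open Scope mset_scope.
Local Open Scope ring_scope.

Definition infinite_type (K : eqType) : Prop :=
  forall s : seq K, exists x, x \notin s.

(* [idealr_closed] includes properness: 1 \notin I. *)
Definition homogeneous_ideal (K : fieldType) n (I : {pred {mpoly K[n]}}) : Prop :=
  idealr_closed I /\ forall p d, p \in I -> pihomog mdeg d p \in I.

(* V is I_d = I \cap R_d inside the vector space R_d of forms of degree d, so
   h d = dim (R/I)_d.  Forms of degree d carry a vector space structure in the
   library only when there is at least one variable; nothing is lost, since
   variables may be killed by I. *)
Definition hilbert_function (K : fieldType) n (I : {pred {mpoly K[n.+1]}})
    (h : nat -> nat) : Prop :=
  forall d, exists2 V : {vspace dhomog n.+1 K d},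
    (forall p : dhomog n.+1 K d, (p \in V) = ((p : {mpoly K[n.+1]}) \in I))
    & h d = (\dim {:dhomog n.+1 K d} - \dim V)%N.

(* For I homogeneous: R/I is Artinian and j is its largest nonzero degree. *)
Definition top_degree (K : fieldType) n (I : {pred {mpoly K[n]}}) (j : nat) : Prop :=
  (exists2 p, p \is j.-homog & p \notin I) /\
  (forall d p, (j < d)%N -> p \is d.-homog -> p \in I).

Definition in_socle (K : fieldType) n (I : {pred {mpoly K[n]}}) (p : {mpoly K[n]}) : Prop :=
  forall i : 'I_n, 'X_i * p \in I.

(* The socle (I : m) / I of R/I has dimension 1 over K. *)
Definition socle_dim1 (K : fieldType) n (I : {pred {mpoly K[n]}}) : Prop :=
  exists p, [/\ in_socle I p, p \notin I &
    forall q, in_socle I q -> exists c : K, q - c *: p \in I].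

Definition AG_ideal (K : fieldType) n (I : {pred {mpoly K[n]}}) (j : nat) : Prop :=
  [/\ homogeneous_ideal I, top_degree I j & socle_dim1 I].

Definition AG_hilbert (K : fieldType) (j : nat) (h : nat -> nat) : Prop :=
  exists2 I : {pred {mpoly K[3]}}, AG_ideal I j & hilbert_function I h.

(* Integer valued, because it is applied to differences. *)
Definition O_sequence (K : fieldType) (h : nat -> int) : Prop :=
  (forall d, h d = 0) \/
  exists n (I : {pred {mpoly K[n.+1]}}) (h' : nat -> nat),
    [/\ homogeneous_ideal I, hilbert_function I h' & forall d, h d = (h' d)%:Z].

Definition entry n (M : 'M[nat]_n) (u v : nat) : nat :=
  match insub u, insub v with
  | Some i, Some j => M i j
  | _, _ => 0%N
  end.

(* The (u-1, v) entry, 0 when u = 0. *)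
Definition entry_up n (M : 'M[nat]_n) (u v : nat) : nat :=
  if u is u'.+1 then entry M u' v else 0%N.

(* The i-th diagonal H(i), continued by 0. *)
Definition diagonal n (M : 'M[nat]_n) (i u : nat) : nat := entry M u (u + i)%N.

Definition diagonal_diff n (M : 'M[nat]_n) (i u : nat) : int :=
  (diagonal M i u)%:Z - (if u is u'.+1 then diagonal M i.+1 u' else 0%N)%:Z.

(* T = (t_0, ..., t_j), so that size T = j + 1. *)
Record potential_rank_matrix (K : fieldType) (T : seq nat)
    (M : 'M[nat]_(size T)) : Prop := PotentialRankMatrix {
  prm_upper : forall u v : 'I_(size T), (v < u)%N -> M u v = 0%N;
  prm_diag0 : forall u, (u < size T)%N -> diagonal M 0 u = nth 0%N T u;
  prm_diag1 : exists u, diagonal M 1 u <> 0%N;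
  prm_gorenstein : forall i, (i < size T)%N ->
    (forall u, diagonal M i u = 0%N) \/
    AG_hilbert K ((size T).-1 - i)%N (diagonal M i);
  prm_diff : forall i, (i < size T)%N -> O_sequence K (diagonal_diff M i);
  prm_rows : forall u v, (u <= v)%N -> (v.+1 < size T)%N ->
    (entry M u v.+1 <= entry M u v)%N;
  prm_columns : forall u v, (u < v)%N -> (v < size T)%N ->
    (entry M u v <= entry M u.+1 v)%N;
  prm_squares : forall u v, (u < v)%N -> (v.+1 < size T)%N ->
    (entry M u v + entry M u.+1 v.+1 <= entry M u.+1 v + entry M u v.+1)%N;
  prm_plateau : forall u v u' v',
    (u <= v < size T)%N -> (u' <= v' < size T)%N ->
    (forall w, w \in [:: u; v; u'; v'] -> nth 0%N T w = (\max_(t <- T) t)%N) ->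
    (v - u = v' - u')%N -> entry M u v = entry M u' v'
}.

(* D is the Jordan degree type attached to M; a pair (p, nu) stands for a
   string of length p starting in degree nu. *)
Definition jordan_degree_type_of n (M : 'M[nat]_n) (D : {mset nat * nat}) : Prop :=
  (forall u v, (u <= v < n)%N ->
    (D ((v - u)%N.+1, u))%:Z =
      (entry M u v)%:Z + (entry_up M u v.+1)%:Z
      - (entry_up M u v)%:Z - (entry M u v.+1)%:Z) /\
  (forall x, x \in D -> exists u v, (u <= v < n)%N /\ x = ((v - u)%N.+1, u)).

Definition potential_jordan_degree_type (K : fieldType) (T : seq nat)
    (D : {mset nat * nat}) : Prop :=
  exists2 M : 'M[nat]_(size T),
    potential_rank_matrix K M & jordan_degree_type_of M D.

Definition has_exactly (n : nat) (X : eqType) (P : X -> Prop) : Prop :=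
  exists s : seq X, [/\ uniq s, size s = n & forall x, x \in s <-> P x].

(* (1, 3, 4^k, 3, 1) *)
Definition T34 (k : nat) : seq nat := ([:: 1; 3] ++ nseq k 4 ++ [:: 3; 1])%N.

(* Main.v *)
From HB Require Import structures.
Require Import Defs.
From mathcomp Require Import all_boot all_order all_algebra.
From mathcomp Require Import finmap multiset.
From mathcomp.multinomials Require Import mpoly.
From mathcomp Require Import zify ring.

Set Implicit Arguments.
Unset Strict Implicit.
Unset Printing Implicit Defensive.

Import Order.TTheory GRing.Theory Num.Theory.
Local Open Scope mset_scope.
Local Open Scope ring_scope.

(** Let T = (1, 3, 4^k, 3, 1) and j = k + 3.  By Gorenstein symmetry, which is
    a consequence of the one-dimensional socle ([AG_pairing],
    [AG_hilbert_le]), and by the plateau condition, a diagonal H(i) of a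
    potential rank matrix is determined by its entries at distance 0, 1 and at
    least 2 from its nearer end.  These three numbers are the profile of H(i).
    Hence M_(u,v) is the entry of index min(u, j - v, 2) in the profile of
    H(v - u), and M is the same thing as a sequence of j + 1 profiles that
    starts with the profile of T.

    All conditions on M become local in this sequence.  They relate at most
    three consecutive profiles, and a position (u, v) enters only through
    min(u, 3) and min(j - v, 3); each of them is therefore a finite computation
    which is the same for all diagonals that are long enough.

    Algebra is used in two directions.  For necessity, two weak facts are
    enough: the symmetry above, and the first case of Macaulay's bound, that a
    Hilbert function which is at most 1 in some positive degree cannot increase
    afterwards ([hilbert_weak_growth]).  An exhaustive comparison of
    consecutive profiles ([necessary_steps_suffice]) shows that, starting from
    T, these facts and the monotonicity of rows and columns leave only the
    profiles (0,0,0), (1,1,1), (1,2,2), (1,2,3), (1,3,3), (1,3,4) and force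
    every difference H(i) - (0, H(i+1)) with H(i+1) nonzero to be a Hilbert
    function of an algebra in two variables.  For sufficiency, the nonzero
    profiles are realized by the inverse systems of the forms
    X^(e-b) Y^b + eps Z^e in divided powers, with eps equal to 0 or 1, on which
    the variables act by contraction; this works in every characteristic
    ([binomial_AG]).  The differences are realized by monomial ideals in two
    variables ([two_variable_O_sequence]).

    The sequences of profiles are thus the paths of a finite automaton whose
    rule depends on the distance e to the end only when e < 6.  For each pair
    of consecutive profiles the number of continuations is the same at
    distances 6 and 7, hence at all larger distances ([count_chains_stable]),
    and the total number of sequences is 26 ([size_all_chains]).

    Finally, the multiplicities of a Jordan degree type are second differences
    of M.  They are nonnegative by the conditions on rows, columns and squares,
    and M is recovered from them by summation, so that potential Jordan degree
    types are as many as potential rank matrices. *)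

(** * Ideals and Hilbert functions *)

Lemma dhomog_ind (K : fieldType) n d (P : {mpoly K[n]} -> Prop) :
    P 0 -> (forall c m q, mdeg m = d -> P q -> P (c *: 'X_[m] + q)) ->
  forall p, p \is d.-homog -> P p.
Proof.
move=> P0 Pstep p /dhomogP hom_p; rewrite (mpolyE p).
elim: (msupp p) hom_p => [|m s IHs] hom_p; first by rewrite big_nil.
rewrite big_cons; apply: Pstep; first by apply: hom_p; rewrite inE eqxx.
by apply: IHs => m' m's; apply: hom_p; rewrite inE m's orbT.
Qed.

Lemma dhomog_mulX (K : fieldType) n d (p : {mpoly K[n]}) i :
  p \is d.-homog -> 'X_i * p \is d.+1.-homog.
Proof. by rewrite -[d.+1]add1n; apply: dhomogM; rewrite dhomogX /= mdeg1. Qed.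

Section IdealFacts.

Variables (K : fieldType) (n : nat) (I : {pred {mpoly K[n]}}).
Hypothesis idI : idealr_closed I.

Lemma ideal0 : 0 \in I. Proof. by case: idI. Qed.

Lemma idealM a x : x \in I -> a * x \in I.
Proof. by case: idI => I0 _ + Ix => /(_ a x 0 Ix I0); rewrite addr0. Qed.

Lemma idealD x y : x \in I -> y \in I -> x + y \in I.
Proof. by case: idI => _ _ + Ix Iy => /(_ 1 x y Ix Iy); rewrite mul1r. Qed.

Lemma idealZ c x : x \in I -> c *: x \in I.
Proof. by move=> Ix; rewrite -mul_mpolyC idealM. Qed.

Lemma idealN x : (- x \in I) = (x \in I).
Proof.
by apply/idP/idP => /(idealZ (-1)); rewrite scaleN1r ?opprK.
Qed.

Lemma idealB x y : x \in I -> y \in I -> x - y \in I.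
Proof. by move=> Ix Iy; rewrite idealD // idealN. Qed.

Lemma ideal_monomials d :
    (forall m, mdeg m = d -> 'X_[m] \in I) ->
  forall p, p \is d.-homog -> p \in I.
Proof.
move=> Im; apply: dhomog_ind => [|c m q /Im Xm Iq]; first exact: ideal0.
by rewrite idealD // idealZ.
Qed.

End IdealFacts.

Lemma mdeg_split n d (m : 'X_{1..n}) :
  mdeg m = d.+1 -> exists i m', m = (U_(i) + m')%MM /\ mdeg m' = d.
Proof.
move=> deg_m; have [i mi|m0] := pickP (fun i => m i != 0%N); last first.
  by move: deg_m; rewrite mdegE big1 // => i _; apply/eqP/negbFE/m0.
have le_m : (U_(i) <= m)%MM by rewrite lep1mP.
exists i, (m - U_(i))%MM; split; first by rewrite addmC submK.
by apply/succn_inj; rewrite -deg_m -{2}(submK le_m) mdegD mdeg1 addn1.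
Qed.

Section HilbertFunction.

Variables (K : fieldType) (n : nat) (I : {pred {mpoly K[n.+1]}}).
Variable h : nat -> nat.
Hypotheses (idI : idealr_closed I) (hI : hilbert_function I h).

Lemma hilbert0P d :
  h d = 0%N <-> forall p, p \is d.-homog -> p \in I.
Proof.
have [V memV ->] := hI d; split=> [/eqP le_dim p hom_p|memI].
  have /eqP fullV : V == fullv by rewrite eqEdim subvf -subn_eq0.
  by rewrite -[p]/(mpoly_of_dhomog (DHomog hom_p)) -memV fullV memvf.
suff -> : V = fullv by rewrite subnn.
apply/eqP; rewrite eqEsubv subvf; apply/subvP => -[p hom_p] _.
by rewrite memV memI.
Qed.

(** The condition on the right says that (R/I)_d is spanned by the class of one
    form; it avoids quotients, which makes it usable with polynomials. *)
Lemma hilbert_le1P d :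
  (h d <= 1)%N <-> exists2 w, w \is d.-homog &
     forall p, p \is d.-homog -> exists c, p - c *: w \in I.
Proof.
have [V memV ->] := hI d; split=> [le1|[w hom_w wP]].
  have [w Vw] : exists w : dhomog n.+1 K d, (V^C <= <[w]>)%VS.
    have [V0|nzV] := eqVneq (V^C)%VS 0%VS.
      by exists 0; rewrite V0 sub0v.
    exists (vpick V^C).
    suff /eqP -> : <[vpick V^C]>%VS == V^C%VS by [].
    by rewrite eqEdim dim_vline vpick0 nzV -memvE memv_pick dimv_compl.
  exists w => [|p hom_p]; first exact: dhomog_is_dhomog.
  have /memv_addP[v Vv [_ /(subvP Vw)/vlineP[c ->] Dp]] :
    DHomog hom_p \in (V + V^C)%VS by rewrite addv_complf memvf.
  exists c; rewrite -[p]/(mpoly_of_dhomog (DHomog hom_p)) Dp.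
  by rewrite linearD linearZ /= addrK -memV.
suff: (fullv <= V + <[DHomog hom_w]>)%VS.
  move/dimvS; have := dimv_add_leqif V <[DHomog hom_w]>%VS.
  rewrite dim_vline => -[+ _]; case: (_ != 0) => /=; lia.
apply/subvP => -[p hom_p] _; have [c Ipc] := wP _ hom_p.
apply/memv_addP; exists (DHomog hom_p - c *: DHomog hom_w).
  rewrite memV; exact: Ipc.
by exists (c *: DHomog hom_w); rewrite ?subrK // memvZ ?memv_line.
Qed.

(** This is Macaulay's bound for the value 1.  If a monomial m = x_k m'' spans
    degree d, then x_i m = x_k (x_i m'') is a multiple of x_k m for every i, so
    that x_k m spans degree d + 1. *)
Lemma hilbert_weak_growth d :
  (0 < d)%N -> (h d <= 1)%N -> (h d.+1 <= h d)%N.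
Proof.
case: d => // d _ hd1; have [hd0|hd_gt0] := posnP (h d.+1).
  rewrite hd0 leqn0; apply/eqP/hilbert0P/(ideal_monomials idI) => m.
  move=> /mdeg_split[i [m' [-> deg_m']]]; rewrite mpolyXD idealM //.
  by move/hilbert0P: hd0; apply; rewrite dhomogX; apply/eqP.
have [m deg_m Im] : exists2 m : 'X_{1..n.+1}, mdeg m = d.+1 & 'X_[m] \notin I.
  have [m /andP[/eqP deg_m Im]|allI] :=
    pickP (fun m : 'X_{1..n.+1 < d.+2} =>
             (mdeg m == d.+1) && ('X_[m] \notin I)); first by exists m.
  have /hilbert0P : forall p, p \is d.+1.-homog -> p \in I; last by lia.
  apply: (ideal_monomials idI) => m deg_m.
  have lt_m : (mdeg m < d.+2)%N by rewrite deg_m.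
  by have /= := allI (BMultinom lt_m); rewrite deg_m eqxx /= => /negbFE.
have spanX p : p \is d.+1.-homog -> exists c, p - c *: 'X_[m] \in I.
  have [w hom_w wP] := (hilbert_le1P d.+1).1 hd1.
  have [|c Ic] := wP 'X_[m]; first by rewrite dhomogX; apply/eqP.
  have nz_c : c != 0.
    by apply: contraNneq Im => c0; rewrite c0 scale0r subr0 in Ic.
  move=> /wP[b Ib]; exists (b / c).
  suff -> : p - (b / c) *: 'X_[m] = p - b *: w - (b / c) *: ('X_[m] - c *: w).
    by apply: (idealB idI) => //; apply: (idealZ idI).
  by rewrite scalerBr scalerA divfK // opprB addrA subrK.
have [k [m'' [Dm deg_m'']]] := mdeg_split deg_m.
apply: leq_trans hd_gt0; apply/hilbert_le1P; exists ('X_k * 'X_[m]).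
  by rewrite -mpolyXD dhomogX /= mdegD mdeg1 deg_m.
apply: dhomog_ind => [|c m1 q /mdeg_split[i [m2 [-> deg_m2]]] [a Ia]].
  by exists 0; rewrite scale0r subr0 (ideal0 idI).
have [|b Ib] := spanX 'X_[m2]; first by rewrite dhomogX; apply/eqP.
have [|b' Ib'] := spanX ('X_i * 'X_[m'']).
  by rewrite -mpolyXD dhomogX /= mdegD mdeg1 deg_m''.
(* x_i m2 = b x_i m = b x_k (x_i m'') = b b' x_k m modulo I. *)
exists (c * (b * b') + a).
suff -> : c *: 'X_[U_(i) + m2] + q - (c * (b * b') + a) *: ('X_k * 'X_[m])
  = c *: ('X_i * ('X_[m2] - b *: 'X_[m]))
    + (c * b) *: ('X_k * ('X_i * 'X_[m''] - b' *: 'X_[m]))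
    + (q - a *: ('X_k * 'X_[m])).
  apply: (idealD idI) Ia; apply: (idealD idI); apply: (idealZ idI);
    exact: (idealM idI).
rewrite {2}Dm !mpolyXD -!mul_mpolyC !mpolyCD !mpolyCM; ring.
Qed.

End HilbertFunction.

(** * Symmetry of Gorenstein Hilbert functions *)

Lemma codim1_functional (K : fieldType) (vT : vectType K) (V : {vspace vT}) :
    (\dim V^C <= 1)%N ->
  exists phi : {scalar vT}, forall v, (v \in V) = (phi v == 0).
Proof.
move=> dim1; pose X := [tuple vpick V^C]; pose pi := daddv_pi V^C V.
have capV : (V^C :&: V = 0)%VS by rewrite capvC capv_compl.
have spanX v : pi v \in <<X>>%VS.
  suff /subvP : (V^C <= <<X>>)%VS by apply; apply: memv_pi.
  rewrite span_seq1; have [->|nzV] := eqVneq (V^C)%VS 0%VS; first exact: sub0v.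
  suff /eqP -> : <[vpick V^C]>%VS == V^C%VS by [].
  by rewrite eqEdim dim_vline vpick0 nzV -memvE memv_pick dim1.
exists (coord X ord0 \o pi : {scalar vT}) => v.
have Dv : pi v + daddv_pi V V^C v = v.
  by apply: daddv_pi_add; rewrite // addvC addv_complf memvf.
have Vv : (v \in V) = (pi v == 0).
  apply/idP/eqP => [Vv|pi0]; last by rewrite -Dv pi0 add0r memv_pi.
  suff: pi v \in (V^C :&: V)%VS by rewrite capV memv0 => /eqP.
  rewrite memv_cap memv_pi; suff -> : pi v = v - daddv_pi V V^C v.
    by rewrite memvB // memv_pi.
  by rewrite -{2}Dv addrK.
rewrite Vv /=; apply/eqP/eqP => [->|phi0]; first exact: linear0.
by rewrite (coord_span (spanX v)) big_ord1 phi0 scale0r.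
Qed.

Section Gorenstein.

Variables (K : fieldType) (n : nat) (I : {pred {mpoly K[n.+1]}}).
Variables (h : nat -> nat) (j : nat).
Hypotheses (AGI : AG_ideal I j) (hI : hilbert_function I h).

Let idI : idealr_closed I. Proof. by case: AGI => -[]. Qed.

Lemma AG_hilbert0_gt0 : (0 < h 0)%N.
Proof.
rewrite lt0n; apply/eqP => /(hilbert0P hI)/(_ 1 (dhomog1 _ _)).
by case: idI => _ /negbTE ->.
Qed.

Lemma AG_socle_line w s :
    in_socle I w -> w \notin I -> in_socle I s -> exists c, s - c *: w \in I.
Proof.
case: AGI => _ _ [g [_ _ gP]] soc_w Iw soc_s.
have [c Ic] := gP w soc_w; have [b Ib] := gP s soc_s.
have nz_c : c != 0.
  by apply: contraNneq Iw => c0; rewrite c0 scale0r subr0 in Ic.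
exists (b / c).
suff -> : s - (b / c) *: w = s - b *: g - (b / c) *: (w - c *: g).
  by apply: (idealB idI) => //; apply: (idealZ idI).
by rewrite scalerBr scalerA divfK // opprB addrA subrK.
Qed.

Lemma AG_socle_top p : p \is j.-homog -> in_socle I p.
Proof.
case: AGI => _ [_ topI] _ hom_p i; apply: (topI j.+1) => //.
exact: dhomog_mulX.
Qed.

(** A form p of degree d < j outside I is not in the socle, for the socle is
    spanned by a form of degree j; hence some variable multiplies p outside I,
    and repeating this leads to degree j. *)
Lemma AG_pairing d p :
    (d <= j)%N -> p \is d.-homog -> p \notin I ->
  exists2 m : 'X_{1..n.+1}, mdeg m = (j - d)%N & p * 'X_[m] \notin I.
Proof.
move=> le_dj; have [e De] : exists e, e = (j - d)%N by exists (j - d)%N.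
rewrite -De; elim: e d le_dj De p => [|e IHe] d le_dj De p hom_p Ip.
  by exists 0%MM; rewrite ?mdeg0 // mpolyX0 mulr1.
have [i Iip|soc_p] := pickP (fun i => 'X_i * p \notin I).
  have [||| m deg_m Im] := IHe d.+1 _ _ ('X_i * p) _ Iip; try lia.
    exact: dhomog_mulX.
  exists (U_(i) + m)%MM; first by rewrite mdegD mdeg1 deg_m.
  by rewrite mpolyXD mulrA [p * _]mulrC.
case: AGI => -[_ homI] [[w hom_w Iw] _] _.
have [|c] := AG_socle_line (AG_socle_top hom_w) Iw (s := p).
  by move=> i; apply/negbFE/soc_p.
move/(homI _ d); rewrite pihomogB linearZ /= pihomog_dE //.
rewrite (pihomog_ne0 _ hom_w) ?scaler0 ?subr0 => [Ip'|]; last by apply/eqP; lia.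
by rewrite Ip' in Ip.
Qed.

(** Multiplication followed by a functional with kernel I_j is a pairing between
    degrees d and j - d.  By [AG_pairing] its matrix in bases of complements of
    I_d and I_(j-d) is row free, which bounds the number of its rows by the
    number of its columns.  Exchanging d and j - d gives symmetry. *)
Lemma AG_hilbert_le d : (d <= j)%N -> (h d <= h (j - d))%N.
Proof.
move=> le_dj; have [V memV ->] := hI d; have [V' memV' ->] := hI (j - d)%N.
have [phi phiP] : exists phi : {scalar dhomog n.+1 K j},
    forall p : dhomog n.+1 K j, (mpoly_of_dhomog p \in I) = (phi p == 0).
  have [W memW Dh] := hI j.
  have [|phi phiP] := @codim1_functional _ _ W; last first.
    by exists phi => p; rewrite -memW.
  rewrite dimv_compl -Dh; apply/(hilbert_le1P hI).
  case: AGI => _ [[w hom_w Iw] _] _; exists w => // p hom_p.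
  by apply: AG_socle_line => //; apply: AG_socle_top.
rewrite -!dimv_compl.
have hom_mul (p : dhomog n.+1 K d) (q : dhomog n.+1 K (j - d)) :
  (p : {mpoly K[n.+1]}) * q \is j.-homog.
  rewrite -[X in X.-homog](subnKC le_dj).
  by apply: dhomogM; apply: dhomog_is_dhomog.
pose B := \matrix_(i < \dim V^C, k < \dim V'^C)
  phi (DHomog (hom_mul (vbasis V^C)`_i (vbasis V'^C)`_k)).
suff /eqP <- : row_free B by apply: rank_leq_col.
apply: inj_row_free => v vB.
pose p := \sum_i v 0 i *: (vbasis V^C)`_i.
have Vp : p \in V.
  rewrite memV; apply: contraT => Ip.
  have [m deg_m] := AG_pairing le_dj (dhomog_is_dhomog p) Ip.
  have hom_m : ('X_[m] : {mpoly K[n.+1]}) \is (j - d).-homog.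
    by rewrite dhomogX /= deg_m.
  have /memv_addP[q1 Vq1 [q2 Vq2 Dq]] : DHomog hom_m \in (V' + V'^C)%VS.
    by rewrite addv_complf memvf.
  have pb (k : 'I_(\dim V'^C)) :
      mpoly_of_dhomog p * mpoly_of_dhomog (vbasis V'^C)`_k \in I.
    rewrite -[_ * _]/(mpoly_of_dhomog (DHomog (hom_mul p (vbasis V'^C)`_k))).
    rewrite phiP.
    have -> : DHomog (hom_mul p (vbasis V'^C)`_k) =
        \sum_i v 0 i *: DHomog (hom_mul (vbasis V^C)`_i (vbasis V'^C)`_k).
      apply/val_inj; rewrite /= !raddf_sum mulr_suml /=.
      by apply: eq_bigr => i _; rewrite -scalerAl.
    move/rowP/(_ k): vB; rewrite !mxE => vBk.
    rewrite linear_sum -[X in _ == X]vBk.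
    by apply/eqP/eq_bigr => i _; rewrite linearZ mxE.
  case/negP.
  rewrite -[X in mpoly_of_dhomog p * X]/(mpoly_of_dhomog (DHomog hom_m)).
  rewrite Dq mulrDr.
  apply: (idealD idI); first by rewrite (idealM idI) // -memV'.
  rewrite (coord_vbasis Vq2) [X in _ * X]raddf_sum /= mulr_sumr.
  elim/big_ind: _ => [|a b|k _]; [exact: ideal0|exact: idealD|].
  by have := idealZ idI (coord (vbasis V'^C) k q2) (pb k); rewrite scalerAr.
have: p \in (V :&: V^C)%VS.
  rewrite memv_cap Vp memv_suml // => i _.
  by rewrite memvZ // vbasis_mem // mem_nth // size_tuple.
rewrite capv_compl memv0 => /eqP p0.
have /freeP/(_ (fun i => v 0 i) p0) v0 := basis_free (vbasisP V^C).
by apply/rowP => i; rewrite v0 mxE.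
Qed.

End Gorenstein.

(** * Order ideals of monomials *)

(** The dual family makes the map p |-> (f i p)_i from forms of degree d
    surjective onto K^(h d); its kernel is I_d, so that rank-nullity gives the
    codimension of I_d without knowing the dimension of the space of forms. *)
Lemma hilbert_function_dual (K : fieldType) n (I : {pred {mpoly K[n.+1]}}) h :
    (forall d, exists (f : 'I_(h d) -> {scalar {mpoly K[n.+1]}})
        (e : 'I_(h d) -> {mpoly K[n.+1]}),
      [/\ forall i, e i \is d.-homog, forall i k, f i (e k) = (i == k)%:R &
          forall p, p \is d.-homog -> (p \in I) = [forall i, f i p == 0]]) ->
  hilbert_function I h.
Proof.
move=> dual d; have [f [e [hom_e fe If]]] := dual d.
pose g (p : dhomog n.+1 K d) := \row_i f i (mpoly_of_dhomog p).
have g_lin : linear g.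
  by move=> c p q; apply/rowP => i; rewrite !mxE linearD linearZ.
pose G : {linear dhomog n.+1 K d -> 'rV[K]_(h d)} :=
  HB.pack g (GRing.isLinear.Build _ _ _ _ g g_lin).
exists (lker (linfun G)) => [p|].
  rewrite memv_ker lfunE /= If ?dhomog_is_dhomog //.
  apply/eqP/forallP => [/rowP g0 i|f0].
    by have := g0 i; rewrite !mxE => ->.
  by apply/rowP => i; rewrite !mxE; apply/eqP.
have fullG : limg (linfun G) = fullv.
  apply/eqP; rewrite eqEsubv subvf; apply/subvP => v _.
  suff -> : v = linfun G (\sum_i v 0 i *: DHomog (hom_e i)).
    by rewrite memv_img ?memvf.
  rewrite lfunE /=; apply/rowP => k; rewrite mxE !raddf_sum /= (bigD1 k) //=.
  rewrite linearZ /= fe eqxx mulr1 big1 ?addr0 // => i /negbTE ne_ik.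
  by rewrite linearZ /= fe eq_sym ne_ik mulr0.
by rewrite -(limg_ker_dim (linfun G)) fullG capfv dimvf /dim /= mul1n addKn.
Qed.

Lemma mcoeff_pihomog (K : fieldType) n d (p : {mpoly K[n]}) m :
  (pihomog mdeg d p)@_m = if mdeg m == d then p@_m else 0.
Proof.
have [deg_m|ndeg_m] := ifPn; last first.
  exact: dhomog_nemf_coeff (pihomogP mdeg d p) ndeg_m.
rewrite {2}(pihomog_partitionE (mf := mdeg) (leq_addr d.+1 (msize p))).
rewrite [RHS](raddf_sum (mcoeff m)) /=.
have lt_d : (d < msize p + d.+1)%N by lia.
rewrite (bigD1 (Ordinal lt_d)) //= big1 ?addr0 // => i ne_i.
apply: (dhomog_nemf_coeff (pihomogP mdeg i p)).
apply: contraNneq ne_i => Di; apply/eqP/val_inj.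
by rewrite /= -Di -(eqP deg_m).
Qed.

Section MonomialIdeal.

Variables (K : fieldType) (n : nat) (S : pred 'X_{1..n.+1}).
Hypotheses (S0 : S 0%MM) (S_down : forall m1 m2, S (m1 + m2)%MM -> S m2).

Definition monomial_ideal : {pred {mpoly K[n.+1]}} :=
  [pred p | all (predC S) (msupp p)].

Lemma mem_monomial_ideal (p : {mpoly K[n.+1]}) :
  reflect (forall m, S m -> p@_m = 0) (p \in monomial_ideal).
Proof.
apply: (iffP allP) => [Ip m Sm|p0 m].
  by apply/eqP/contraT; rewrite -mcoeff_msupp => /Ip; rewrite /= Sm.
by rewrite mcoeff_msupp; apply: contraNN => /p0 ->.
Qed.

Lemma monomial_ideal_homogeneous : homogeneous_ideal monomial_ideal.
Proof.
split=> [|p d /mem_monomial_ideal Ip]; last first.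
  by apply/mem_monomial_ideal => m /Ip; rewrite mcoeff_pihomog => ->; case: ifP.
split=> [||a p q /mem_monomial_ideal Ip /mem_monomial_ideal Iq].
- by apply/mem_monomial_ideal => m _; rewrite mcoeff0.
- apply/mem_monomial_ideal => /(_ _ S0)/eqP.
  by rewrite mcoeff1 eqxx oner_eq0.
apply/mem_monomial_ideal => m Sm; rewrite mcoeffD Iq // addr0 mcoeffM.
apply: big1 => -[m1 m2] /= /eqP Dm; rewrite Ip ?mulr0 //.
by apply: (@S_down m1); rewrite -Dm.
Qed.

Lemma monomial_ideal_hilbert h (mon : forall d, 'I_(h d) -> 'X_{1..n.+1}) :
    (forall d, injective (mon d)) ->
    (forall d m, S m && (mdeg m == d) = (m \in codom (mon d))) ->
  hilbert_function monomial_ideal h.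
Proof.
move=> inj_mon monP; apply: hilbert_function_dual => d.
exists (fun i => mcoeff (mon d i)), (fun i => 'X_[mon d i]); split.
- move=> i; rewrite dhomogX.
  by have := codom_f (mon d) i; rewrite -monP => /andP[].
- by move=> i k; rewrite /= mcoeffX (inj_eq (inj_mon d)) eq_sym.
move=> p hom_p; apply/mem_monomial_ideal/forallP => [Ip i|Ip m Sm].
  by rewrite /= Ip //; have := codom_f (mon d) i; rewrite -monP => /andP[].
have [deg_m|] := eqVneq (mdeg m) d; last exact: dhomog_nemf_coeff hom_p.
have : m \in codom (mon d) by rewrite -monP Sm deg_m eqxx.
by case/codomP => i ->; apply/eqP; apply: Ip.
Qed.

End MonomialIdeal.

Arguments monomial_ideal K {n} S.

(** The order ideal keeps, in degree d, the monomials x^(d-l) y^l with l < h d.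
    It is closed under division by variables: either h (d - 1) >= h d, and l
    does not increase, or all d monomials of degree d - 1 are kept. *)
Lemma two_variable_O_sequence (K : fieldType) (D : nat -> int) h :
    (forall d, D d = (h d)%:Z) -> h 0%N = 1%N ->
    (forall d, (h d <= d.+1)%N) ->
    (forall d, (h d.+1 <= h d)%N || (h d == d.+1)) ->
  O_sequence K D.
Proof.
move=> Dh h0 le_h mono_h.
pose mon d (l : 'I_(h d)) : 'X_{1..2} := [multinom [tuple (d - l)%N; val l]].
have deg2 (m : 'X_{1..2}) : mdeg m = (m ord0 + m ord_max)%N.
  by rewrite mdegE big_ord_recl big_ord1; congr (_ + m _)%N; apply: val_inj.
pose S (m : 'X_{1..2}) := (m ord_max < h (mdeg m))%N.
have mon1 d l : mon d l ord_max = l by rewrite multinomE.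
have mon0 d l : mon d l ord0 = (d - l)%N by rewrite multinomE.
right; exists 1%N, (monomial_ideal K S), h; split=> //.
  apply: monomial_ideal_homogeneous; first by rewrite /S mnm0E mdeg0 h0.
  (* Removing one variable at a time reduces to consecutive degrees. *)
  have step i m : S (U_(i) + m)%MM -> S m.
    rewrite /S mdegD mdeg1 mnmDE mnm1E add1n deg2.
    have := mono_h (m ord0 + m ord_max)%N; have := le_h (m ord0 + m ord_max)%N.
    by case: (i == ord_max); lia.
  move=> m1; have [d deg_m1] : exists d, mdeg m1 = d by exists (mdeg m1).
  elim: d m1 deg_m1 => [|d IHd] m1.
    by move/eqP; rewrite mdeg_eq0 => /eqP -> m2; rewrite add0m.
  case/mdeg_split=> i [m' [-> deg_m']] m2; rewrite -addmA => /step.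
  exact: IHd.
apply: (@monomial_ideal_hilbert K 1 S h mon) => [d l l'|d m].
  by move/(congr1 (fun m : 'X_{1..2} => m ord_max)); rewrite !mon1 => /val_inj.
apply/andP/codomP => [[Sm /eqP deg_m]|[l ->]].
  rewrite /S deg_m in Sm; exists (Ordinal Sm).
  apply/mnmP => i; move: deg_m; rewrite deg2.
  case: (unliftP ord_max i) => [i' ->|->]; last by rewrite mon1.
  rewrite (_ : lift _ _ = ord0) ?mon0 /=; first by lia.
  by apply: val_inj; rewrite /= ord1.
have le_ld : (l <= d)%N by have := ltn_ord l; have := le_h d; lia.
by rewrite /S deg2 mon0 mon1 subnK // eqxx ltn_ord.
Qed.

(** * Gorenstein algebras from inverse systems *)

Section ApolarIdeal.

Variables (K : fieldType) (n e : nat) (L : {scalar {mpoly K[n.+1]}}).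
Hypothesis L_deg : forall m, mdeg m != e -> L 'X_[m] = 0.

(** This is the annihilator, for the contraction action, of the form of degree
    e in divided powers whose coefficients are the values of L on monomials:
    the ideal of the polynomials all of whose multiples are killed by L.
    Multiplying by monomials of degree at most e is enough, as L lives in
    degree e; this makes membership decidable. *)
Definition apolar_ideal : {pred {mpoly K[n.+1]}} :=
  [pred p | [forall m : 'X_{1..n.+1 < e.+1}, L (p * 'X_[m]) == 0]].

Lemma functional_homog d p : p \is d.-homog -> d != e -> L p = 0.
Proof.
move=> hom_p ne_d; move: p hom_p; apply: dhomog_ind => [|c m q deg_m Lq].
  exact: linear0.
by rewrite linearD linearZ /= Lq addr0 L_deg ?mulr0 // deg_m.
Qed.

Lemma mem_apolar_ideal p :
  reflect (forall q, L (q * p) = 0) (p \in apolar_ideal).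
Proof.
apply: (iffP forallP) => [Lp q|Lp m]; last by rewrite mulrC Lp.
rewrite (mpolyE q) mulr_suml linear_sum big1 // => m _.
rewrite -scalerAl linearZ /= ['X_[m] * p]mulrC.
have [le_m|lt_m] := leqP (mdeg m) e.
  have /eqP /= := Lp (BMultinom (leq_ltn_trans le_m (ltnSn e))) => ->.
  by rewrite mulr0.
rewrite (mpolyE p) mulr_suml linear_sum big1 ?mulr0 // => m' _.
rewrite -scalerAl linearZ /= -mpolyXD L_deg ?mulr0 // mdegD; lia.
Qed.

Lemma apolar_idealP d p : p \is d.-homog ->
  (p \in apolar_ideal) <->
    (forall m, (mdeg m + d)%N = e -> L (p * 'X_[m]) = 0).
Proof.
move=> hom_p; split=> [/mem_apolar_ideal Lp m _|Lp]; first by rewrite mulrC Lp.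
apply/forallP => m; apply/eqP.
have [/Lp //|ne_e] := eqVneq (mdeg m + d)%N e.
apply: (@functional_homog (d + mdeg m)); last by rewrite addnC.
by apply: dhomogM; rewrite ?dhomogX.
Qed.

Hypothesis L_nz : exists2 m, mdeg m = e & L 'X_[m] != 0.

(** If all x_i q lie in the ideal, then L (q m) = 0 for every monomial m other
    than 1, so that q is determined modulo the ideal by the number L q. *)
Lemma apolar_ideal_AG : AG_ideal apolar_ideal e.
Proof.
have [m0 deg_m0 Lm0] := L_nz.
have hom_m0 : ('X_[m0] : {mpoly K[n.+1]}) \is e.-homog.
  by rewrite dhomogX /= deg_m0.
have Im0 : 'X_[m0] \notin apolar_ideal.
  apply/negP => /mem_apolar_ideal/(_ 1); rewrite mul1r => L0.
  by rewrite L0 eqxx in Lm0.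
have top d p : (e < d)%N -> p \is d.-homog -> p \in apolar_ideal.
  by move=> lt_ed hom_p; apply/(apolar_idealP hom_p) => m; lia.
have idI : idealr_closed apolar_ideal.
  split=> [||a p q /mem_apolar_ideal Lp /mem_apolar_ideal Lq].
  - by apply/mem_apolar_ideal => q; rewrite mulr0 linear0.
  - apply: contra Im0 => /mem_apolar_ideal L1.
    by apply/mem_apolar_ideal => q; rewrite -[_ * _]mulr1 L1.
  by apply/mem_apolar_ideal => r; rewrite mulrDr linearD mulrA Lp Lq addr0.
split; first split=> // p d /mem_apolar_ideal Lp.
- apply/(apolar_idealP (pihomogP mdeg d p)) => m deg_m.
  rewrite -(Lp 'X_[m]).
  rewrite [X in _ = L (_ * X)]
            (pihomog_partitionE (mf := mdeg) (leq_addr d.+1 (msize p))).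
  have lt_d : (d < msize p + d.+1)%N by lia.
  rewrite mulr_sumr linear_sum (bigD1 (Ordinal lt_d)) //= mulrC.
  rewrite big1 ?addr0 // => i ne_i.
  apply: (@functional_homog (mdeg m + i)).
    by apply: dhomogM; rewrite ?dhomogX ?pihomogP.
  by apply: contraNneq ne_i => Di; apply/eqP/val_inj => /=; lia.
- by split=> //; exists 'X_[m0].
have soc_m0 : in_socle apolar_ideal 'X_[m0].
  by move=> i; apply: (top e.+1) => //; apply: dhomog_mulX.
exists 'X_[m0]; split=> // q soc_q; exists (L q / L 'X_[m0]).
apply/forallP => m; rewrite mulrBl linearB -scalerAl linearZ /=.
case deg_m: (mdeg m) => [|d].
  have -> : (m : 'X_{1..n.+1}) = 0%MM by apply/eqP; rewrite -mdeg_eq0 deg_m.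
  by rewrite mpolyX0 !mulr1 divfK ?subrr.
have [i [m' [-> _]]] := mdeg_split deg_m.
have socL s : in_socle apolar_ideal s -> L (s * 'X_[U_(i) + m']) = 0.
  move/(_ i)/mem_apolar_ideal/(_ 'X_[m']).
  by rewrite mulrA mulrC -mpolyXD addmC.
by rewrite !socL // mulr0 subrr.
Qed.

End ApolarIdeal.

Lemma mcoeffMX_sub (K : fieldType) n (p : {mpoly K[n]}) (m t : 'X_{1..n}) :
  (p * 'X_[m])@_t = if (m <= t)%MM then p@_(t - m) else 0.
Proof.
have [le_mt|nle_mt] := ifPn; first by rewrite -{1}(submK le_mt) addmC mcoeffMX.
apply: memN_msupp_eq0; rewrite (perm_mem (msuppMX p m)).
by apply: contra nle_mt => /mapP[m' _ ->]; apply: lem_addr.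
Qed.

Definition mnm3 a b c : 'X_{1..3} := [multinom [tuple a; b; c]].

Lemma mnm3_eta (m : 'X_{1..3}) :
  m = mnm3 (m ord0) (m (lift ord0 ord0)) (m ord_max).
Proof.
by apply/mnmP => -[[|[|[|i]]] lt_i] //=; rewrite multinomE /tnth /=;
  congr (m _); apply: val_inj.
Qed.

Lemma mdeg_mnm3 a b c : mdeg (mnm3 a b c) = (a + b + c)%N.
Proof. by rewrite mdegE !big_ord_recl big_ord0 !multinomE addn0 addnA. Qed.

Lemma eq_mnm3 a b c a' b' c' :
  (mnm3 a b c == mnm3 a' b' c') = [&& a == a', b == b' & c == c'].
Proof.
apply/eqP/and3P => [E|[/eqP-> /eqP-> /eqP->]] //.
have Ei i : mnm3 a b c i = mnm3 a' b' c' i by rewrite E.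
have := (Ei ord0, Ei (lift ord0 ord0), Ei ord_max).
by rewrite !multinomE /tnth /= => -[[-> ->] ->].
Qed.

Lemma lem_mnm3 a b c a' b' c' :
  (mnm3 a b c <= mnm3 a' b' c')%MM = [&& a <= a', b <= b' & c <= c']%N.
Proof.
apply/mnm_lepP/and3P => [le_m|[le_a le_b le_c] [[|[|[|i]]] lt_i]] //;
  rewrite ?multinomE //.
have := (le_m ord0, le_m (lift ord0 ord0), le_m ord_max).
by rewrite !multinomE /tnth /= => -[[-> ->] ->].
Qed.

Section BinomialApolar.

Variables (K : fieldType) (e b : nat) (eps : bool).
Hypotheses (le_b : (b.*2 <= e)%N) (e_gt0 : eps -> (0 < e)%N).

(** The minimum counts the divisors of degree d of X^(e-b) Y^b; the form Z^e
    contributes one more divisor, except in degrees 0 and e. *)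
Definition binomial_h d : nat :=
  (minn (minn d b).+1 (e.+1 - d) + (eps && (0 < d < e)))%N.

(** The monomials X^(e-b) Y^b and Z^e have no common divisor except 1.  Hence,
    in degrees d < e, the ideal apolar to X^(e-b) Y^b + eps Z^e consists of the
    forms whose coefficients vanish at all divisors of the monomials that occur
    in this form; in degree e there is only the condition L = 0. *)
Lemma binomial_AG : AG_hilbert K e binomial_h.
Proof.
pose t1 := mnm3 (e - b) b 0; pose t2 := mnm3 0 0 e.
pose L0 (p : {mpoly K[3]}) : K := p@_t1 + eps%:R * p@_t2.
have L0_lin : scalar L0.
  by move=> c p q; rewrite /L0 !mcoeffD !mcoeffZ; ring.
pose L : {scalar {mpoly K[3]}} :=
  HB.pack L0 (GRing.isLinear.Build _ _ _ _ L0 L0_lin).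
have LE p : L p = p@_t1 + eps%:R * p@_t2 by [].
have deg_t1 : mdeg t1 = e by rewrite mdeg_mnm3; lia.
have deg_t2 : mdeg t2 = e by rewrite mdeg_mnm3.
have L_deg m : mdeg m != e -> L 'X_[m] = 0.
  move=> ne_m; rewrite LE !mcoeffX.
  have [Dm|_] := eqVneq m t1; first by rewrite Dm deg_t1 eqxx in ne_m.
  have [Dm|_] := eqVneq m t2; first by rewrite Dm deg_t2 eqxx in ne_m.
  by rewrite mulr0 addr0.
have Lt1 : L 'X_[t1] = 1.
  rewrite LE !mcoeffX eqxx eq_mnm3.
  case: eps e_gt0 => [/(_ isT) e0|_]; last by rewrite mul0r addr0.
  by rewrite mul1r (_ : [&& _, _ & _] = false) ?addr0 //; lia.
exists (apolar_ideal e L).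
  by apply: apolar_ideal_AG => //; exists t1; rewrite // Lt1 oner_neq0.
apply: hilbert_function_dual => d.
have [lt_ed|le_de] := ltnP e d.
  have h0 : binomial_h d = 0%N by rewrite /binomial_h; lia.
  rewrite h0; exists (fun _ => mcoeff 0), (fun _ => 0).
  split=> [[]|[]|p hom_p] //.
  rewrite (_ : [forall i, _] = true); last by apply/forallP => -[].
  by apply/(apolar_idealP L_deg hom_p) => m; lia.
have [Dd|ne_de] := eqVneq d e.
  have h1 : binomial_h d = 1%N by rewrite /binomial_h; lia.
  rewrite h1; exists (fun _ => L), (fun _ => 'X_[t1]); split=> [i|i k|p hom_p].
  - by rewrite dhomogX Dd; apply/eqP.
  - by rewrite [i]ord1 [k]ord1.
  apply/idP/forallP => [/(apolar_idealP L_deg hom_p) Ip i|/(_ ord0)/eqP Lp].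
    by rewrite -[p]mulr1 -mpolyX0 Ip ?mdeg0.
  apply/(apolar_idealP L_deg hom_p) => m deg_m.
  have /eqP : mdeg m = 0%N by lia.
  by rewrite mdeg_eq0 => /eqP ->; rewrite mpolyX0 mulr1.
have lt_de : (d < e)%N by lia.
(* The monomials of degree d dividing x^(e-b) y^b have y-exponent at least
   d + b - e. *)
pose r := (minn (minn d b).+1 (e.+1 - d))%N; pose l0 := (d + b - e)%N.
pose mon (i : 'I_(binomial_h d)) :=
  if (i < r)%N then mnm3 (d - (l0 + i)) (l0 + i) 0 else mnm3 0 0 d.
have bin_h : binomial_h d = (r + (eps && (0 < d)))%N.
  by rewrite /binomial_h lt_de andbT.
have lt_mon (i : 'I_(binomial_h d)) : (i < r + (eps && (0 < d)))%N.
  by rewrite -bin_h ltn_ord.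
have deg_mon i : mdeg (mon i) = d.
  by rewrite /mon; case: ifP; rewrite mdeg_mnm3 /r /l0; lia.
have inj_mon : injective mon.
  move=> i k /eqP; rewrite /mon; have := lt_mon i; have := lt_mon k.
  by case: ifP; case: ifP; rewrite eq_mnm3 /r => *; apply: val_inj => /=; lia.
have monP s : mdeg s = d ->
    (s <= t1)%MM || eps && (s <= t2)%MM -> exists i, s = mon i.
  rewrite (mnm3_eta s) mdeg_mnm3 !lem_mnm3; move: (s _) (s _) (s _) => w v u Dd.
  move=> s_t; pose i := if (0 < w)%N then r else (v - l0)%N.
  have lt_i : (i < binomial_h d)%N.
    by rewrite bin_h /i /r /l0; case: ifP; move: s_t; lia.
  exists (Ordinal lt_i); apply/eqP; rewrite /mon /= /i; case: (ltnP 0 w) => w0.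
    by rewrite ltnn eq_mnm3; move: s_t; lia.
  by rewrite ifT ?eq_mnm3 /r /l0; move: s_t; lia.
have mon_t i : (mon i <= t1)%MM || eps && (mon i <= t2)%MM.
  by have := lt_mon i; rewrite /mon; case: ifP; rewrite !lem_mnm3 /r /l0; lia.
have Lcoef p m : (0 < mdeg m)%N -> L (p * 'X_[m]) =
    if (m <= t1)%MM then p@_(t1 - m)
    else if (m <= t2)%MM then eps%:R * p@_(t2 - m) else 0.
  rewrite LE !mcoeffMX_sub (mnm3_eta m) mdeg_mnm3 !lem_mnm3.
  move: (m _) (m _) (m _) => w v u uvw_gt0.
  case: ifP; case: ifP; rewrite ?(mulr0, addr0, add0r) //; lia.
have IP p : p \is d.-homog ->
    (p \in apolar_ideal e L) = [forall i, p@_(mon i) == 0].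
  move=> hom_p; apply/idP/forallP => [/(apolar_idealP L_deg hom_p) Ip i|Ip].
    have sub_t t : (mon i <= t)%MM -> mdeg t = e ->
        [/\ (t - (t - mon i) = mon i)%MM, (mdeg (t - mon i)%MM + d)%N = e
          & (t - mon i <= t)%MM].
      move=> le_t deg_t; rewrite lem_subr; split=> //.
        by rewrite submBA // addmC addmK.
      by rewrite -deg_t -{2}(submK le_t) mdegD deg_mon.
    have [le_t1|nle_t1] := boolP (mon i <= t1)%MM.
      have [Dt deg_m le_m] := sub_t _ le_t1 deg_t1.
      by have := Ip _ deg_m; rewrite Lcoef ?le_m ?Dt; [move=> ->|lia].
    have := mon_t i; rewrite (negbTE nle_t1) /= => /andP[eps1 le_t2].
    have [Dt deg_m le_m] := sub_t _ le_t2 deg_t2.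
    have := Ip _ deg_m; rewrite Lcoef ?le_m ?Dt; last by lia.
    rewrite eps1 mul1r; case: ifP => [le_m1|_ ->] //.
    (* t2 - mon i would divide both monomials, but it has degree e - d > 0. *)
    have := deg_m; move: le_m le_m1.
    rewrite (mnm3_eta (t2 - _)) mdeg_mnm3 !lem_mnm3; lia.
  apply/(apolar_idealP L_deg hom_p) => m deg_m; rewrite Lcoef; last by lia.
  have sub_t t : (m <= t)%MM -> mdeg t = e -> mdeg (t - m)%MM = d.
    by move=> le_t deg_t; have := mdegD (t - m) m; rewrite submK //; lia.
  case: ifP => [le_t1|_].
    have [|i ->] := monP _ (sub_t _ le_t1 deg_t1); first by rewrite lem_subr.
    exact/eqP.
  case: ifP => // le_t2; case: eps monP; rewrite ?mul0r // => monP.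
  have [|i ->] := monP _ (sub_t _ le_t2 deg_t2); first by rewrite lem_subr orbT.
  by rewrite (eqP (Ip i)) mulr0.
exists (fun i => mcoeff (mon i)), (fun i => 'X_[mon i]); split=> // [i|i k].
  by rewrite dhomogX /= deg_mon.
by rewrite /= mcoeffX (inj_eq inj_mon) eq_sym.
Qed.

End BinomialApolar.

(** * Consequences for Gorenstein Hilbert functions and O-sequences *)

Lemma AG_hilbertP (K : fieldType) e h : AG_hilbert K e h ->
  [/\ (0 < h 0)%N, forall d, (d <= e)%N -> h (e - d)%N = h d &
      forall d, (0 < d)%N -> (h d <= 1)%N -> (h d.+1 <= h d)%N].
Proof.
case=> I AGI hI; split; first exact: AG_hilbert0_gt0 AGI hI.
  move=> d le_de; apply/eqP; rewrite eqn_leq (AG_hilbert_le AGI hI le_de) andbT.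
  by rewrite -{2}(subKn le_de) (AG_hilbert_le AGI hI) ?leq_subr.
by case: AGI => -[idI _] _ _; apply: hilbert_weak_growth idI hI.
Qed.

Lemma eq_AG_hilbert (K : fieldType) e h h' :
  h =1 h' -> AG_hilbert K e h -> AG_hilbert K e h'.
Proof. by move=> eq_h [I AGI hI]; exists I => // d; rewrite -eq_h. Qed.

Lemma AG_O_sequence (K : fieldType) e h (D : nat -> int) :
  AG_hilbert K e h -> (forall d, D d = (h d)%:Z) -> O_sequence K D.
Proof. by case=> I [homI _ _] hI Dh; right; exists 2%N, I, h. Qed.

Lemma O_sequence_growth (K : fieldType) (D : nat -> int) d :
  O_sequence K D -> (0 < d)%N -> D d <= 1 -> D d.+1 <= D d.
Proof.
case=> [D0|[n [I [h [[idI _] hI Dh]]]]] d_gt0; first by rewrite !D0.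
by rewrite !Dh !lez_nat; apply: hilbert_weak_growth idI hI _ d_gt0.
Qed.

(** * Profiles of diagonals *)

Local Open Scope nat_scope.

(** The three entries are the values of [binomial_h e b eps] at distance 0, 1
    and at least 2 from the ends, when b <= 2 and 4 <= e. *)
Definition binomial_profile (b : nat) (eps : bool) : seq nat :=
  [:: 1; (minn b 1).+1 + eps; b.+1 + eps].

(** In a diagonal of socle degree e the distance t to the nearer end satisfies
    2 t <= e; the other entries of a profile are set to 0, so that a diagonal
    has only one profile. *)
Definition truncate e (s : seq nat) : seq nat :=
  mkseq (fun t => if t.*2 <= e then nth 0 s t else 0) 3.

(** The entry of a diagonal with profile s at distances x and y from its first
    and last entries; thus x = u and y = j - v for the entry (u, v). *)
Definition cell (s : seq nat) x y : nat := nth 0 s (minn (minn x y) 2).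

Definition zero_profile : seq nat := nseq 3 0.

Definition T_profile := binomial_profile 2 true.

Definition profiles e : seq (seq nat) :=
  undup [seq truncate e s | s <- [:: zero_profile;
    binomial_profile 0 false; binomial_profile 0 true;
    binomial_profile 2 false; binomial_profile 1 true; T_profile]].

(** This tests P on the positions x + y = e.  The conditions of interest depend
    only on min(x, 3) and min(y, 3), and these pairs are the same for e as for
    min(e, 6): see [on_diagonalP]. *)
Definition on_diagonal e (P : nat -> nat -> bool) :=
  all (fun x => P x (minn e 6 - x)) (iota 0 (minn e 6).+1).

Lemma on_diagonalP e (P : nat -> nat -> bool) :
    (forall x y, P x y = P (minn x 3) (minn y 3)) ->
  reflect (forall x y, x + y = e -> P x y) (on_diagonal e P).
Proof.
move=> capP; apply: (iffP allP) => [Px x y De|Pxy x].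
  pose x' := minn x (maxn (minn e 6 - y) 3).
  have /Px : x' \in iota 0 (minn e 6).+1 by rewrite mem_iota /x'; lia.
  by rewrite capP (capP x y); congr (P _ _); rewrite /x'; lia.
rewrite mem_iota => le_x; pose y := minn e 6 - x.
pose x' := if x <= 3 then x else e - y.
have : P x' (e - x') by apply: Pxy; rewrite /x' /y; case: ifP; lia.
by rewrite capP (capP x); congr (P _ _); rewrite /x' /y; case: ifP; lia.
Qed.

(** The difference H(i) - (0, H(i+1)) in degree x, where s and s' are the
    profiles of H(i) and H(i+1), and y is the distance to the end of H(i). *)
Definition diff (s s' : seq nat) x y : nat :=
  cell s x y - (if x is x'.+1 then cell s' x' y else 0).

(** In the next three conditions e is the socle degree of the diagonal with
    profile s'; (x, y) is a position on it, and (x, y + 1) and (x + 1, y) are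
    the positions next to it on the preceding diagonal. *)
Definition monotone_step e (s s' : seq nat) :=
  on_diagonal e (fun x y =>
    (cell s' x y <= cell s x y.+1) && (cell s' x y <= cell s x.+1 y)).

(** The conditions of [two_variable_O_sequence] for the difference of the two
    diagonals, between the degrees x and x + 1.  When s' is zero the difference
    is the Hilbert function of s itself. *)
Definition O_sequence_step e (s s' : seq nat) :=
  (s' == zero_profile) || on_diagonal e (fun x y =>
    (diff s s' x.+1 y <= (minn x 3).+2) &&
    ((diff s s' x.+1 y <= diff s s' x y.+1) ||
     (x < 3) && (diff s s' x y.+1 == x.+1))).

Definition square_condition e (s0 s s' : seq nat) :=
  on_diagonal e (fun x y =>
    cell s x y.+1 + cell s x.+1 y <= cell s0 x.+1 y.+1 + cell s' x y).

Definition successors e (s : seq nat) : seq (seq nat) :=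
  [seq s' <- profiles e | monotone_step e s s' && O_sequence_step e s s'].

(** The continuations of a sequence of profiles that ends with s0, s, where e is
    the socle degree of s, hence also the number of profiles still to come. *)
Fixpoint chains e (s0 s : seq nat) : seq (seq (seq nat)) :=
  if e is e'.+1 then
    [seq s' :: l |
      s' <- [seq s' <- successors e' s | square_condition e' s0 s s'],
      l <- chains e' s s']
  else [:: [::]].

Fixpoint count_chains e (s0 s : seq nat) : nat :=
  if e is e'.+1 then
    sumn [seq count_chains e' s s' |
           s' <- [seq s' <- successors e' s | square_condition e' s0 s s']]
  else 1.

Definition all_chains j : seq (seq (seq nat)) :=
  [seq s' :: l |
    s' <- [seq s' <- successors j.-1 T_profile | s' != zero_profile],
    l <- chains j.-1 T_profile s'].

(** * Counting chains of profiles *)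

Lemma truncate_cap e s : truncate (minn e 6) s = truncate e s.
Proof.
apply/eq_in_map => t; rewrite mem_iota => lt_t.
by have -> : (t.*2 <= minn e 6) = (t.*2 <= e) by lia.
Qed.

Lemma profiles_cap e : profiles (minn e 6) = profiles e.
Proof. by congr undup; apply: eq_map => s; apply: truncate_cap. Qed.

Lemma on_diagonal_cap e P : on_diagonal (minn e 6) P = on_diagonal e P.
Proof. by rewrite /on_diagonal -minnA minnn. Qed.

Lemma successors_cap e s : successors (minn e 6) s = successors e s.
Proof.
rewrite /successors profiles_cap; apply: eq_filter => s'.
by rewrite /monotone_step /O_sequence_step !on_diagonal_cap.
Qed.

Lemma successors_profiles e s s' : s' \in successors e s -> s' \in profiles e.
Proof. by rewrite mem_filter => /andP[]. Qed.

Lemma size_chains e s0 s : size (chains e s0 s) = count_chains e s0 s.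
Proof.
elim: e s0 s => //= e IHe s0 s; rewrite size_allpairs_dep; congr sumn.
by apply: eq_map => s'.
Qed.

Lemma uniq_chains e s0 s : uniq (chains e s0 s).
Proof.
elim: e s0 s => //= e IHe s0 s; apply: allpairs_uniq_dep => //.
  by rewrite !filter_uniq ?undup_uniq.
by move=> [s1 l1] [s2 l2] _ _ /= [-> ->].
Qed.

(** From distance 6 on, the count at distance e + 1 is a function F, not
    depending on e, of the counts at distance e.  The counts at distances 6 and
    7 agree on all pairs of profiles, so that they are a fixed point of F. *)
Lemma count_chains_stable e s0 s : s0 \in profiles 6 -> s \in profiles 6 ->
  count_chains (e + 6) s0 s = count_chains 6 s0 s.
Proof.
elim: e s0 s => // e IHe s0 s s0_6 s_6.
have count7 : all (fun s0 => all (fun s =>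
    count_chains 7 s0 s == count_chains 6 s0 s) (profiles 6)) (profiles 6).
  by vm_compute.
rewrite -(eqP (allP (allP count7 _ s0_6) _ s_6)).
rewrite addSn [LHS]/= [RHS]/=; congr sumn.
have cap6 : minn (e + 6) 6 = 6 by lia.
rewrite -[successors (e + 6) s]successors_cap cap6.
have eq_square : square_condition (e + 6) s0 s =1 square_condition 6 s0 s.
  by move=> s'; rewrite /square_condition -on_diagonal_cap cap6.
rewrite (eq_filter eq_square); apply/eq_in_map => s'.
by rewrite mem_filter => /andP[_ /successors_profiles s'_6]; apply: IHe.
Qed.

Lemma size_all_chains j : 6 <= j -> size (all_chains j) = 26.
Proof.
move=> j6; have [->|ne6] := eqVneq j 6; first by vm_compute.
rewrite /all_chains size_allpairs_dep.
have [e De] : exists e, j.-1 = e + 6 by exists (j - 7); lia.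
rewrite De -successors_cap (_ : minn _ 6 = 6); last by lia.
pose starts := [seq s <- successors 6 T_profile | s != zero_profile].
suff -> : [seq size (chains (e + 6) T_profile s) | s <- starts]
        = [seq count_chains 6 T_profile s | s <- starts] by vm_compute.
apply/eq_in_map => s; rewrite mem_filter => /andP[_ /successors_profiles s_6].
by rewrite size_chains count_chains_stable //; vm_compute.
Qed.

Lemma uniq_all_chains j : uniq (all_chains j).
Proof.
apply: allpairs_uniq_dep => [|s _|]; rewrite ?uniq_chains //.
  by rewrite !filter_uniq ?undup_uniq.
by move=> [s1 l1] [s2 l2] _ _ /= [-> ->].
Qed.

Lemma mem_chains e s0 s l :
  reflect (size l = e /\ forall i, i < e ->
     let f := nth [::] [:: s0, s & l] in
     (f i.+2 \in successors (e - i.+1) (f i.+1)) &&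
     square_condition (e - i.+1) (f i) (f i.+1) (f i.+2))
   (l \in chains e s0 s).
Proof.
elim: e s0 s l => [|e IHe] s0 s l.
  by rewrite inE; apply: (iffP eqP) => [->|[/size0nil]].
apply: (iffP allpairsPdep) => [[s' [l' [ss' /IHe[size_l' l'P] ->]]]|].
  split=> [|[|i] lt_i]; first by rewrite /= size_l'.
    by move: ss'; rewrite mem_filter andbC subn1.
  exact: l'P.
case: l => [[]|s' l [[size_l] lP]] //; exists s', l; split=> //.
  by rewrite mem_filter andbC; have := lP 0 isT; rewrite subn1.
by apply/IHe; split=> // i lt_i; apply: (lP i.+1).
Qed.

(** The sequences of profiles of potential rank matrices, indexed by the
    diagonals 0, ..., j. *)
Definition profile_chain j (f : nat -> seq nat) :=
  [/\ f 0 = T_profile, f 1 != zero_profile,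
      forall i, i < j -> f i.+1 \in successors (j - i.+1) (f i) &
      forall i, i.+1 < j ->
        square_condition (j - i.+2) (f i) (f i.+1) (f i.+2)].

Lemma mem_all_chains j l : 0 < j ->
  reflect (size l = j /\ profile_chain j (nth [::] (T_profile :: l)))
          (l \in all_chains j).
Proof.
case: j => // j _; apply: (iffP allpairsPdep).
  case=> s [l' [ts /mem_chains[size_l' l'P] ->]].
  move: ts; rewrite mem_filter => /andP[nz_s ts].
  split; first by rewrite /= size_l'.
  split=> // [[|i] lt_i|i lt_i]; first by rewrite subn1.
    by have /andP[] := l'P i lt_i.
  by have /andP[] := l'P i lt_i.
case: l => [[]|s l [[size_l] [_ nz_s succ_l conv_l]]] //.
exists s, l; split=> //.
  by rewrite mem_filter nz_s; have := succ_l 0 isT; rewrite subn1.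
apply/mem_chains; split=> // i lt_i /=.
by rewrite (succ_l i.+1) // (conv_l i).
Qed.

(** * Local conditions on profiles *)

Lemma cell_cap s x y : cell s (minn x 3) (minn y 3) = cell s x y.
Proof. by congr nth; lia. Qed.

Lemma cell_capSl s x y : cell s (minn x 3).+1 (minn y 3) = cell s x.+1 y.
Proof. by congr nth; lia. Qed.

Lemma cell_capSr s x y : cell s (minn x 3) (minn y 3).+1 = cell s x y.+1.
Proof. by congr nth; lia. Qed.

Lemma cell_capSS s x y : cell s (minn x 3).+1 (minn y 3).+1 = cell s x.+1 y.+1.
Proof. by congr nth; lia. Qed.

Lemma diff_capl s s' x y :
  diff s s' (minn x 3).+1 (minn y 3) = diff s s' x.+1 y.
Proof. by rewrite /diff cell_capSl cell_cap. Qed.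

Lemma diff_capr s s' x y :
  diff s s' (minn x 3) (minn y 3).+1 = diff s s' x y.+1.
Proof.
rewrite /diff cell_capSr; case: x => // x; rewrite minnSS; congr (_ - _).
by congr nth; lia.
Qed.

Definition capE :=
  (cell_cap, cell_capSl, cell_capSr, cell_capSS, diff_capl, diff_capr).

Lemma monotone_stepP e s s' :
  reflect (forall x y, x + y = e ->
             cell s' x y <= cell s x y.+1 /\ cell s' x y <= cell s x.+1 y)
          (monotone_step e s s').
Proof.
apply: (iffP (on_diagonalP _ _)) => [x y|N x y /N/andP|N x y /N/andP] //.
by rewrite !capE.
Qed.

Lemma square_conditionP e s0 s s' :
  reflect (forall x y, x + y = e ->
             cell s x y.+1 + cell s x.+1 y <= cell s0 x.+1 y.+1 + cell s' x y)
          (square_condition e s0 s s').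
Proof. by apply: on_diagonalP => x y; rewrite !capE. Qed.

Lemma O_sequence_stepP e s s' : O_sequence_step e s s' -> s' != zero_profile ->
  forall x y, x + y = e ->
    diff s s' x.+1 y <= x.+2 /\
    (diff s s' x.+1 y <= diff s s' x y.+1 \/ diff s s' x y.+1 = x.+1).
Proof.
case/orP=> [-> //|/on_diagonalP stair _ x y /stair/andP[|le_x le_diff]].
  by move=> x' y'; rewrite !capE; lia.
split; first by lia.
by case/orP: le_diff => [|/andP[_ /eqP]]; [left|right].
Qed.

Lemma profiles_truncate e s : s \in profiles e -> s = truncate e s.
Proof.
rewrite mem_undup => /mapP[s' _ ->]; apply/eq_in_map => t.
by rewrite mem_iota => lt_t; rewrite nth_mkseq //; case: ifP.
Qed.

Lemma T_profile_profiles j : 6 <= j -> T_profile \in profiles j.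
Proof. by move=> j6; rewrite -profiles_cap (minn_idPr j6); vm_compute. Qed.

Lemma cell_zero_profile x y : cell zero_profile x y = 0.
Proof. by rewrite /cell nth_nseq; case: ifP. Qed.

(** When the socle degree e is at most 3 the profile does not determine b and
    eps; the choice min(b, e / 2), with eps only for e > 0, always works. *)
Lemma profiles_AG (K : fieldType) e s : s \in profiles e ->
  s = zero_profile \/
  AG_hilbert K e (fun d => if d <= e then cell s d (e - d) else 0).
Proof.
rewrite mem_undup map_cons inE => /orP[/eqP->|/mapP[s0 s0P ->]]; [left|right].
  by rewrite /truncate /mkseq /= !if_same.
have [b [eps [b2 ->]]] : exists b eps, b <= 2 /\ s0 = binomial_profile b eps.
  by move: s0P; rewrite !inE => /or4P[|||/orP[]] /eqP ->;
    [exists 0, false|exists 0, true|exists 2, false|exists 1, true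
    |exists 2, true].
apply: eq_AG_hilbert
         (@binomial_AG K e (minn b e./2) (eps && (0 < e)) _ _); try lia.
move=> d; rewrite /binomial_h /cell nth_mkseq; last by lia.
case: (leqP d e) => le_de; last by lia.
rewrite ifT; last by lia.
have [t Dt] : exists t, t = minn (minn d (e - d)) 2 by eexists.
rewrite -Dt; case: t Dt => [|[|[|t]]] Dt /=; case: eps; lia.
Qed.

(** * From chains to potential rank matrices *)

Lemma entry_out n (M : 'M[nat]_n) u v : (n <= u) || (n <= v) -> entry M u v = 0.
Proof.
rewrite /entry => /orP[le_n|le_n].
  by rewrite insubN // -leqNgt.
by case: insub => // i; rewrite insubN // -leqNgt.
Qed.

Section MatrixOfChain.

Variables (n : nat) (f : nat -> seq nat).

Definition chain_matrix : 'M[nat]_n :=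
  \matrix_(u, v) if u <= v then cell (f (v - u)) u (n.-1 - v) else 0.

Lemma entry_ord (M : 'M[nat]_n) (u v : 'I_n) : entry M u v = M u v.
Proof. by rewrite /entry !valK. Qed.

Lemma entry_chain_matrix u v : u <= v < n ->
  entry chain_matrix u v = cell (f (v - u)) u (n.-1 - v).
Proof.
case/andP=> le_uv lt_v; have lt_u := leq_ltn_trans le_uv lt_v.
by rewrite (entry_ord chain_matrix (Ordinal lt_u) (Ordinal lt_v)) mxE /= le_uv.
Qed.

Lemma diagonal_chain_matrix i u : i < n ->
  diagonal chain_matrix i u =
    if u <= n.-1 - i then cell (f i) u (n.-1 - i - u) else 0.
Proof.
move=> lt_i; rewrite /diagonal; case: ifP => le_u; last first.
  by rewrite entry_out ?orbT //; lia.
by rewrite entry_chain_matrix ?addKn; last lia; congr cell; lia.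
Qed.

Definition matrix_profile (M : 'M[nat]_n) i : seq nat :=
  mkseq (fun t => if t.*2 <= n.-1 - i then diagonal M i t else 0) 3.

Lemma matrix_profile_chain_matrix i :
    i < n -> f i \in profiles (n.-1 - i) ->
  matrix_profile chain_matrix i = f i.
Proof.
move=> lt_i /profiles_truncate ->; apply/eq_in_map => t.
rewrite mem_iota => lt_t; case: ifP => // le_t.
by rewrite diagonal_chain_matrix // ifT; [congr nth|]; lia.
Qed.

End MatrixOfChain.

Lemma profiles_head e s :
  s \in profiles e -> s = zero_profile \/ forall y, cell s 0 y = 1.
Proof.
rewrite mem_undup map_cons inE => /orP[/eqP->|/mapP[s0 s0P ->]]; [left|right].
  by rewrite /truncate /mkseq /= !if_same.
move=> y; rewrite /cell !min0n /=.
by move: s0P; rewrite !inE => /or4P[|||/orP[]] /eqP ->.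
Qed.

Section Plateau.

Variable k : nat.
Hypothesis k_ge3 : 3 <= k.

Local Notation n := (size (T34 k)).

Lemma size_T34 : size (T34 k) = k + 4.
Proof. by rewrite /T34 !size_cat size_nseq /=; lia. Qed.

Lemma nth_T34 w : w < k + 4 -> nth 0 (T34 k) w = cell T_profile w (k + 3 - w).
Proof.
move=> lt_w; rewrite /T34 !nth_cat size_nseq nth_nseq /cell.
have [t Dt] : exists t, t = minn (minn w (k + 3 - w)) 2 by eexists.
rewrite -Dt; case: (ltnP w 2) => [|le_w] /=.
  case: w lt_w Dt => [|[|w]] //= _ -> _; rewrite ?min0n //.
  by rewrite (_ : minn _ 2 = 1) //; lia.
case: ltnP => [lt_wk|le_kw]; first by rewrite (_ : t = 2) //; lia.
have : w - 2 - k < 2 by lia.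
case Dw: (w - 2 - k) => [|[|m]] //= _; first by rewrite (_ : t = 1) //; lia.
by rewrite (_ : t = 0) //; lia.
Qed.

Lemma max_T34 : \max_(t <- T34 k) t = 4.
Proof.
apply/eqP; rewrite eqn_leq; apply/andP; split.
  apply/bigmax_leqP_seq => t; rewrite !mem_cat mem_nseq !inE => + _; lia.
apply: (@leq_bigmax_seq _ _ xpredT id 4) => //.
by rewrite !mem_cat mem_nseq !inE; lia.
Qed.

Lemma plateau_T34 w : w < n ->
  (nth 0 (T34 k) w == \max_(t <- T34 k) t) = (2 <= w <= k.+1).
Proof.
rewrite size_T34 max_T34 => lt_w; rewrite nth_T34 // /cell.
have [t Dt] : exists t, t = minn (minn w (k + 3 - w)) 2 by eexists.
by rewrite -Dt; case: t Dt => [|[|[|t]]] /=; lia.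
Qed.

Variable K : fieldType.

Lemma chain_profiles j f : 6 <= j -> profile_chain j f ->
  forall i, i <= j -> f i \in profiles (j - i).
Proof.
move=> j6 [f0 _ succ_f _] [_|i lt_i].
  by rewrite f0 subn0 T_profile_profiles.
exact: successors_profiles (succ_f i lt_i).
Qed.

(** The conditions on rows, columns and squares are those of the chain, read at
    the position x = u, y = j - v.  The differences H(i) - (0, H(i+1))
    come from an algebra in two variables, except those with H(i+1) = 0, which
    are Gorenstein Hilbert functions or zero. *)
Lemma potential_chain_matrix f :
  profile_chain (k + 3) f -> potential_rank_matrix K (chain_matrix n f).
Proof.
move=> chain_f; have Dn : n.-1 = k + 3 by rewrite size_T34; lia.
have profiles_f i : i < n -> f i \in profiles (k + 3 - i).
  by rewrite size_T34 => lt_i; apply: (chain_profiles _ chain_f); lia.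
case: chain_f => f0 nz_f1 succ_f conv_f.
have step i : i < k + 3 -> monotone_step (k + 3 - i.+1) (f i) (f i.+1) /\
                           O_sequence_step (k + 3 - i.+1) (f i) (f i.+1).
  by move=> /succ_f; rewrite mem_filter => /andP[/andP[]].
have diagE i u : i < n -> diagonal (chain_matrix n f) i u =
    if u <= k + 3 - i then cell (f i) u (k + 3 - i - u) else 0.
  by move=> lt_i; rewrite diagonal_chain_matrix // Dn.
have AG_f i : i < n -> (forall u, diagonal (chain_matrix n f) i u = 0) \/
    AG_hilbert K (k + 3 - i) (diagonal (chain_matrix n f) i).
  move=> lt_i.
  case: (profiles_AG K (profiles_f i lt_i)) => [Di|AGi]; [left|right].
    by move=> u; rewrite diagE // Di cell_zero_profile if_same.
  by apply: eq_AG_hilbert AGi => u; rewrite diagE.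
have entryE u v : u <= v < n ->
    entry (chain_matrix n f) u v = cell (f (v - u)) u (k + 3 - v).
  by move=> lt_uv; rewrite entry_chain_matrix // Dn.
split.
- by move=> u v lt_vu; rewrite mxE leqNgt lt_vu.
- move=> u lt_u; rewrite diagE; last by lia.
  by rewrite nth_T34 -?size_T34 // f0 ifT; [congr cell|]; lia.
- have [u /eqP ne0|all0] :=
    pickP (fun u : 'I_(k + 3) => diagonal (chain_matrix n f) 1 u != 0).
    by exists u.
  case/negP: nz_f1; apply/eqP.
  have lt1 : 1 < n by rewrite size_T34; lia.
  rewrite -(@matrix_profile_chain_matrix n f 1) ?Dn ?profiles_f //.
  rewrite [RHS](_ : _ = mkseq (fun=> 0) 3) //.
  apply/eq_in_map => t; rewrite mem_iota => lt_t; case: ifP => // le_t.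
  have lt_t' : t < k + 3 by lia.
  by have /eqP := all0 (Ordinal lt_t').
- by move=> i lt_i; rewrite Dn; apply: AG_f.
- move=> i lt_i.
  have D_le d :
      diagonal (chain_matrix n f) i.+1 d <= diagonal (chain_matrix n f) i d.+1.
    have [lt_Si|le_Si] := ltnP i.+1 n; last first.
      by rewrite /diagonal entry_out ?orbT //; lia.
    rewrite !diagE //; case: ifP => // le_d; rewrite ifT; last by lia.
    have [|/monotone_stepP nar _] := step i; first by rewrite -Dn; lia.
    have [|_ le_c] := nar d (k + 3 - i.+1 - d); first by lia.
    by rewrite (_ : k + 3 - i - d.+1 = k + 3 - i.+1 - d) //; lia.
  have [Z|[lt_Si nz_Si]] : (forall u, diagonal (chain_matrix n f) i.+1 u = 0) \/
      (i.+1 < n /\ f i.+1 != zero_profile).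
  - have [lt_Si|le_Si] := ltnP i.+1 n; last first.
      by left=> u; rewrite /diagonal entry_out ?orbT //; lia.
    have [Di|] := eqVneq (f i.+1) zero_profile; [left=> u|by right].
    by rewrite diagE // Di cell_zero_profile if_same.
  - have DE d : diagonal_diff (chain_matrix n f) i d =
                Posz (diagonal (chain_matrix n f) i d).
      by rewrite /diagonal_diff; case: d => [|d]; rewrite ?Z subr0.
    case: (AG_f i lt_i) => [Z0|AGi]; last exact: AG_O_sequence AGi DE.
    by left=> d; rewrite DE Z0.
  have [|/monotone_stepP nar /O_sequence_stepP/(_ nz_Si) stair] := step i.
    by rewrite -Dn; lia.
  have [e De] : exists e, e = k + 3 - i.+1 by eexists.
  have head1 y : cell (f i) 0 y = 1.
    case: (profiles_head (profiles_f i lt_i)) => [Zi|-> //].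
    case: (profiles_head (profiles_f i.+1 lt_Si)) => [Z1|head1].
      by rewrite Z1 eqxx in nz_Si.
    by have [|] := nar 0 (k + 3 - i.+1); rewrite // head1 Zi cell_zero_profile.
  rewrite -De in stair; pose h d := diagonal (chain_matrix n f) i d -
    (if d is d'.+1 then diagonal (chain_matrix n f) i.+1 d' else 0).
  have hE d : h d = if d <= e.+1 then diff (f i) (f i.+1) d (e.+1 - d) else 0.
    have Dei : k + 3 - i = e.+1 by lia.
    rewrite /h diagE // Dei; case: d => [|d] //.
    rewrite diagE // -De ltnS subSS.
    by case: ifP.
  apply: (@two_variable_O_sequence K _ h) => [d|||d].
  - rewrite /diagonal_diff /h; case: d => [|d]; first by rewrite subr0 subn0.
    by rewrite subzn.
  - by rewrite hE /diff subn0 head1.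
  - move=> d; rewrite hE; case: d => [|d]; first by rewrite /diff subn0 head1.
    by case: ifP => // le_d; have [|] := stair d (e.+1 - d.+1); first by lia.
  rewrite !hE ltnS; case: ifP => le_d; last by rewrite leq0n.
  have [|_] := stair d (e - d); first by lia.
  by rewrite (leqW le_d) subSS subSn // => -[->|->]; rewrite ?eqxx ?orbT.
- move=> u v le_uv lt_v; rewrite !entryE; try lia.
  have [|/monotone_stepP nar _] := step (v - u); first by lia.
  by rewrite subSn //; have [|le_c _] := nar u (k + 3 - v.+1); first lia;
    rewrite (_ : k + 3 - v = (k + 3 - v.+1).+1) //; lia.
- move=> u v lt_uv lt_v; rewrite !entryE; try lia.
  have [|/monotone_stepP nar _] := step (v - u.+1); first by lia.
  have Dvu : v - u = (v - u.+1).+1 by lia.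
  by rewrite Dvu; have [|_] := nar u (k + 3 - v); first lia.
- move=> u v lt_uv lt_v; rewrite !entryE; try lia.
  pose i := v - u.+1; have /square_conditionP conv :
      square_condition (k + 3 - i.+2) (f i) (f i.+1) (f i.+2).
    by apply: conv_f; rewrite /i; lia.
  have := conv u (k + 3 - v.+1); rewrite /i (_ : v.+1 - u.+1 = v - u) //.
  rewrite (_ : v.+1 - u = (v - u.+1).+2); last by lia.
  rewrite (_ : (v - u.+1).+1 = v - u); last by lia.
  by rewrite (_ : k + 3 - v = (k + 3 - v.+1).+1); [apply; lia|lia].
- move=> u v u' v' uv uv' wP Dv.
  have T w : w \in [:: u; v; u'; v'] -> w < n -> 2 <= w <= k.+1.
    by move=> /wP/eqP + lt_w; rewrite plateau_T34.
  have := T u; have := T v; have := T u'; have := T v'.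
  rewrite !inE !eqxx !orbT => /(_ isT) Tv' /(_ isT) Tu' /(_ isT) Tv /(_ isT) Tu.
  have {Tu Tv Tu' Tv'} [] : [/\ 2 <= u, v <= k.+1, 2 <= u' & v' <= k.+1].
    by split; [have := Tu|have := Tv|have := Tu'|have := Tv']; lia.
  by move=> u2 vk u2' vk'; rewrite !entryE // Dv; congr nth; lia.
Qed.

End Plateau.

(** * From potential rank matrices to chains *)

(** What the conditions on a potential rank matrix give at once for consecutive
    diagonals, through [AG_hilbertP] and [O_sequence_growth]. *)
Definition necessary_step e (s s' : seq nat) :=
  [&& monotone_step e s s',
      (s' == zero_profile) || (0 < cell s' 0 0) &&
        (if e is e'.+1 then
           on_diagonal e' (fun x y => (0 < x) ==> (cell s' x y.+1 <= 1) ==>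
             (cell s' x.+1 y <= cell s' x y.+1))
         else true) &
      on_diagonal e (fun x y => (0 < x) ==> (diff s s' x y.+1 <= 1) ==>
        (diff s s' x.+1 y <= diff s s' x y.+1))].

(** The entries of [T_profile] are 1, 3, 4, and profiles decrease along a chain
    by monotonicity of rows. *)
Definition candidates e : seq (seq nat) :=
  [seq truncate e [:: p.1.1; p.1.2; p.2] |
    p <- allpairs pair (allpairs pair (iota 0 2) (iota 0 4)) (iota 0 5)].

Lemma mem_candidates e p a c : p <= 1 -> a <= 3 -> c <= 4 ->
  truncate e [:: p; a; c] \in candidates e.
Proof.
move=> le_p le_a le_c; apply/mapP; exists ((p, a), c) => //.
by do 2!rewrite allpairs_f ?mem_iota //.
Qed.

Lemma candidates_cap e : candidates (minn e 6) = candidates e.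
Proof. by apply: eq_map => s; apply: truncate_cap. Qed.

Definition necessary_steps_suffice_in e :=
  all (fun s => all (fun s' => necessary_step e s s' ==>
   ((s' \in profiles e) && O_sequence_step e s s')) (candidates e))
   (profiles e.+1).

Lemma necessary_steps_suffice_cap e :
  necessary_steps_suffice_in (minn e 7) = necessary_steps_suffice_in e.
Proof.
have profiles_eq m m' : minn m 6 = minn m' 6 -> profiles m = profiles m'.
  by move=> Em; rewrite -profiles_cap Em profiles_cap.
have candidates_eq m m' : minn m 6 = minn m' 6 -> candidates m = candidates m'.
  by move=> Em; rewrite -candidates_cap Em candidates_cap.
have diagonal_eq m m' P :
    minn m 6 = minn m' 6 -> on_diagonal m P = on_diagonal m' P.
  by move=> Em; rewrite -on_diagonal_cap Em on_diagonal_cap.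
case: e => // e; rewrite minnSS /necessary_steps_suffice_in.
rewrite (profiles_eq (minn e 6).+2 e.+2); last by lia.
rewrite (profiles_eq (minn e 6).+1 e.+1); last by lia.
rewrite (candidates_eq (minn e 6).+1 e.+1); last by lia.
apply: eq_all => s; apply: eq_all => s'.
rewrite /necessary_step /monotone_step /O_sequence_step on_diagonal_cap.
have cap : minn (minn e 6).+1 6 = minn e.+1 6 by lia.
by rewrite !(diagonal_eq _ _ _ cap).
Qed.

(** Exhaustive verification: after one of the six profiles, the conditions of
    [necessary_step] exclude every other profile.  For instance (1,3,2) can
    follow only profiles whose third entry is 3 or 4; the difference is then
    at most 1 in degree 2 and larger in degree 3. *)
Lemma necessary_steps_suffice e : necessary_steps_suffice_in e.
Proof.
have ok7 : all necessary_steps_suffice_in (iota 0 8) by vm_compute.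
rewrite -necessary_steps_suffice_cap; have := allP ok7 (minn e 7).
by rewrite mem_iota; apply; lia.
Qed.

Lemma necessary_step_successor e s s' :
    s \in profiles e.+1 -> s' \in candidates e ->
  necessary_step e s s' -> s' \in successors e s.
Proof.
move=> s_e s'_e adm; rewrite mem_filter.
have /allP/(_ _ s_e)/allP/(_ _ s'_e)/implyP/(_ adm)/andP[-> ->] :=
  necessary_steps_suffice e.
by case/and3P: adm => ->.
Qed.

Lemma profiles_le e s : s \in profiles e ->
  forall t, nth 0 s t <= nth 0 T_profile t.
Proof.
rewrite mem_undup => /mapP[s0 s0P ->] t.
have [lt_t|le_t] := ltnP t 3; last by rewrite nth_default ?size_mkseq.
rewrite nth_mkseq //; case: ifP => // _.
move: s0P; rewrite !inE => /or4P[|||/or3P[]] /eqP ->;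
  by case: t lt_t => [|[|[|t]]].
Qed.

Section ReadMatrix.

Variables (k : nat) (K : fieldType).
Hypothesis k_ge3 : 3 <= k.

Local Notation n := (size (T34 k)).

Variable M : 'M[nat]_n.
Hypothesis potM : potential_rank_matrix K M.

Let Dn : n.-1 = k + 3. Proof. by rewrite size_T34; lia. Qed.
Let Dn' : n = k + 4. Proof. exact: size_T34. Qed.

(** Symmetry brings the position u to the half where u <= j - i - u, and the
    plateau condition brings u >= 2 to 2. *)
Lemma diagonal_profile i u : i < n -> u <= k + 3 - i ->
  diagonal M i u = cell (matrix_profile M i) u (k + 3 - i - u).
Proof.
move=> lt_i le_u; have symM : diagonal M i (k + 3 - i - u) = diagonal M i u.
  case: (prm_gorenstein potM lt_i) => [Z|]; first by rewrite !Z.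
  by rewrite Dn => /AG_hilbertP[_ -> //].
have profileE t : t <= 2 -> t.*2 <= k + 3 - i ->
    nth 0 (matrix_profile M i) t = diagonal M i t.
  by move=> le_t le_t2; rewrite nth_mkseq // Dn le_t2.
have plateauE t : 2 <= t -> 2 <= k + 3 - i - t ->
    diagonal M i t = diagonal M i 2.
  move=> le_2t le_t2; rewrite /diagonal.
  have inT w : 2 <= w <= k.+1 -> nth 0 (T34 k) w = \max_(s <- T34 k) s.
    by move=> ltw; apply/eqP; rewrite plateau_T34 // Dn'; lia.
  apply: (prm_plateau potM); [lia|lia| |lia].
  by move=> w; rewrite !inE => /or4P[] /eqP ->; apply: inT; lia.
rewrite /cell profileE; [|lia|lia].
have [le_u2|lt_2u] := leqP u (minn (k + 3 - i - u) 1).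
  by congr diagonal; lia.
have [le_v2|lt_2v] := leqP (k + 3 - i - u) 1.
  by rewrite -symM; congr diagonal; lia.
by rewrite plateauE; [congr diagonal|..]; lia.
Qed.

Lemma matrix_profile_chain : profile_chain (k + 3) (matrix_profile M).
Proof.
have lt_0n : 0 < n by rewrite Dn'; lia.
have profile0 : matrix_profile M 0 = T_profile.
  rewrite -[RHS](_ : mkseq (nth 0 T_profile) 3 = _) //; apply/eq_in_map => t.
  rewrite mem_iota => lt_t; rewrite ifT; last by rewrite Dn; lia.
  rewrite (prm_diag0 potM) ?nth_T34 //; last by rewrite Dn'; lia.
    by rewrite /cell; congr nth; lia.
  by lia.
have monotoneM i : i < k + 3 ->
    monotone_step (k + 3 - i.+1) (matrix_profile M i) (matrix_profile M i.+1).
  move=> lt_i; apply/monotone_stepP => x y Dxy.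
  have lt_in : i.+1 < n by rewrite Dn'; lia.
  have cellE' := diagonal_profile lt_in.
  have cellE := diagonal_profile (ltnW lt_in).
  have <- : diagonal M i.+1 x = cell (matrix_profile M i.+1) x y.
    by rewrite cellE'; [congr cell|]; lia.
  have <- : diagonal M i x = cell (matrix_profile M i) x y.+1.
    by rewrite cellE; [congr cell|]; lia.
  have <- : diagonal M i x.+1 = cell (matrix_profile M i) x.+1 y.
    by rewrite cellE; [congr cell|]; lia.
  rewrite /diagonal; split.
    by rewrite addnS (prm_rows potM) ?leq_addr //; lia.
  by rewrite addnS addSn (prm_columns potM) //; lia.
have step i : i < k + 3 -> matrix_profile M i \in profiles (k + 3 - i) ->
    matrix_profile M i.+1 \in successors (k + 3 - i.+1) (matrix_profile M i).
  move=> lt_i s_i; have lt_in : i.+1 < n by rewrite Dn'; lia.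
  have Dei : k + 3 - i = (k + 3 - i.+1).+1 by lia.
  have cellE u : u <= k + 3 - i ->
      diagonal M i u = cell (matrix_profile M i) u (k + 3 - i - u).
    by move=> le_u; rewrite diagonal_profile //; lia.
  have cellE' := diagonal_profile lt_in.
  have nar := monotoneM i lt_i.
  move: Dei cellE cellE' s_i nar; set e := k + 3 - i.+1.
  move=> Dei; rewrite Dei => cellE cellE' s_i nar.
  apply: necessary_step_successor => //.
    have le_T t : t <= 2 ->
        nth 0 (matrix_profile M i.+1) t <= nth 0 T_profile t.
      move=> le_t; rewrite nth_mkseq // Dn -/e; case: ifP => // le_te.
      rewrite cellE'; last by lia.
      apply: leq_trans (profiles_le s_i t).
      have /monotone_stepP/(_ t (e - t)) [|le_c _] := nar; first by lia.
      apply: leq_trans le_c _; rewrite /cell.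
      by set m := minn _ _; have -> : m = t by lia.
    pose r := matrix_profile M i.+1.
    have -> : matrix_profile M i.+1 =
              truncate e [:: nth 0 r 0; nth 0 r 1; nth 0 r 2].
      rewrite {1}/matrix_profile Dn -/e; apply/eq_in_map => t.
      rewrite mem_iota => lt_t; case: ifP => // le_te.
      have -> : nth 0 [:: nth 0 r 0; nth 0 r 1; nth 0 r 2] t = nth 0 r t.
        by case: t lt_t le_te => [|[|[|t]]].
      by rewrite nth_mkseq // Dn -/e le_te.
    by apply: mem_candidates; apply: le_T.
  rewrite /necessary_step nar /=; apply/andP; split.
    have [Z|AGi] := prm_gorenstein potM lt_in.
      apply/orP; left; rewrite -[zero_profile](_ : mkseq (fun=> 0) 3 = _) //.
      by apply/eqP/eq_in_map => t _; rewrite Z if_same.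
    apply/orP; right; have [h0 _ grow] := AG_hilbertP AGi.
    rewrite -[cell _ 0 0](_ : diagonal M i.+1 0 = _) ?h0 /=; last first.
      by rewrite cellE' // /cell !min0n.
    case De: e => [|e'] //; apply/on_diagonalP => [x y|x y Dxy].
      by rewrite !capE; congr (_ ==> _); lia.
    apply/implyP => x_gt0; apply/implyP.
    have <- : diagonal M i.+1 x = cell (matrix_profile M i.+1) x y.+1.
      by rewrite cellE'; [congr cell|]; lia.
    have <- : diagonal M i.+1 x.+1 = cell (matrix_profile M i.+1) x.+1 y.
      by rewrite cellE'; [congr cell|]; lia.
    exact: grow.
  apply/on_diagonalP => [x y|x y Dxy].
    by rewrite !capE; congr (_ ==> _); lia.
  apply/implyP => x_gt0; apply/implyP.
  have DE d : d <= e.+1 -> diagonal_diff M i d =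
      Posz (diff (matrix_profile M i) (matrix_profile M i.+1) d (e.+1 - d)).
    move=> le_d; rewrite /diagonal_diff /diff cellE; last by [].
    case: d le_d => [|d] le_d; first by rewrite !subn0 subr0.
    rewrite cellE'; last by lia.
    have /monotone_stepP/(_ d (e - d)) [|_ le_c] := nar; first by lia.
    by rewrite subSS subzn.
  have := O_sequence_growth (prm_diff potM (ltnW lt_in)) x_gt0.
  rewrite !DE; [|lia|lia].
  have [-> ->] : e.+1 - x = y.+1 /\ e.+1 - x.+1 = y by lia.
  by rewrite !lez_nat.
have profiles_f i : i <= k + 3 -> matrix_profile M i \in profiles (k + 3 - i).
  elim: i => [|i IHi] le_i.
    by rewrite profile0 subn0 T_profile_profiles //; lia.
  apply: (@successors_profiles _ (matrix_profile M i)).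
  by apply: step => //; apply: IHi; lia.
split=> // [|i lt_i|i lt_i].
- apply/eqP => profile1; have [u] := prm_diag1 potM; case.
  have [le_u|lt_u] := leqP u (k + 3 - 1); last first.
    by rewrite /diagonal entry_out ?orbT //; lia.
  by rewrite diagonal_profile ?profile1 ?cell_zero_profile //; lia.
- by apply: step => //; apply: profiles_f; lia.
apply/square_conditionP => x y Dxy.
have <- : diagonal M i.+1 x = cell (matrix_profile M i.+1) x y.+1.
  by rewrite diagonal_profile; [congr cell| |]; lia.
have <- : diagonal M i.+1 x.+1 = cell (matrix_profile M i.+1) x.+1 y.
  by rewrite diagonal_profile; [congr cell| |]; lia.
have <- : diagonal M i x.+1 = cell (matrix_profile M i) x.+1 y.+1.
  by rewrite diagonal_profile; [congr cell| |]; lia.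
have <- : diagonal M i.+2 x = cell (matrix_profile M i.+2) x y.
  by rewrite diagonal_profile; [congr cell| |]; lia.
have := prm_squares potM (_ : x < x + i.+1) (_ : (x + i.+1).+1 < n).
by rewrite /diagonal !addSn !addnS; apply; lia.
Qed.

Lemma chain_matrix_of_profiles f :
  (forall i, i < n -> f i = matrix_profile M i) -> chain_matrix n f = M.
Proof.
move=> Ef; apply/matrixP => u v; rewrite mxE.
case: leqP => [le_uv|lt_vu]; last by rewrite (prm_upper potM).
have lt_v := ltn_ord v; rewrite Ef; last by lia.
rewrite -(entry_ord M) Dn.
rewrite -[k + 3 - v](_ : k + 3 - (v - u) - u = _); last by lia.
by have := Dn'; rewrite -diagonal_profile /diagonal ?subnKC //; lia.
Qed.

End ReadMatrix.

(** * Jordan degree types *)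

Section JordanDegreeType.

Variable n : nat.
Implicit Types (M : 'M[nat]_n) (D : {mset nat * nat}).

Definition multiplicity M u v : int :=
  (entry M u v)%:Z + (entry_up M u v.+1)%:Z
  - (entry_up M u v)%:Z - (entry M u v.+1)%:Z.

Definition strings : seq (nat * nat) :=
  [seq ((v - u).+1, u) | u <- iota 0 n, v <- iota u (n - u)].

Lemma stringsP x :
  reflect (exists u v, u <= v < n /\ x = ((v - u).+1, u)) (x \in strings).
Proof.
apply: (iffP allpairsPdep) => [[u [v [un vn ->]]]|[u [v [uv ->]]]].
  by exists u, v; split=> //; move: un vn; rewrite !mem_iota; lia.
by exists u, v; rewrite !mem_iota; split=> //; lia.
Qed.

Definition jordan_type M : {mset nat * nat} :=
  [fsfun x in seq_fset tt strings => `|multiplicity M x.2 (x.2 + x.1).-1| | 0].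

Lemma jordan_typeE M u v : u <= v < n ->
  jordan_type M ((v - u).+1, u) = `|multiplicity M u v|.
Proof.
move=> uv; rewrite fsfun_fun seq_fsetE ifT; last by apply/stringsP; exists u, v.
by have -> : (u + (v - u).+1).-1 = v by lia.
Qed.

Lemma jordan_typeP M :
    (forall u v, u <= v < n -> (0 <= multiplicity M u v)%R) ->
  jordan_degree_type_of M (jordan_type M).
Proof.
move=> mult_ge0; split=> [u v uv|x].
  by rewrite jordan_typeE // gez0_abs ?mult_ge0.
rewrite -mset_neq0 fsfun_fun seq_fsetE.
by case: ifP => // /stringsP.
Qed.

Lemma jordan_degree_type_unique M D D' :
  jordan_degree_type_of M D -> jordan_degree_type_of M D' -> D = D'.
Proof.
move=> [DM memD] [D'M memD']; apply/msetP => x.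
have [/stringsP[u [v [uv ->]]]|nx] := boolP (x \in strings).
  by have := DM u v uv; rewrite -D'M // => -[].
have /mset_eq0P -> : x \notin D by apply: contra nx => /memD/stringsP.
by have /mset_eq0P -> : x \notin D' by apply: contra nx => /memD'/stringsP.
Qed.

(** The multiplicity at (u, v) expresses M_(u,v) through entries further up or
    further right, and these vanish outside the matrix; the induction runs on
    the distance to its upper right corner. *)
Lemma jordan_degree_type_inj M M' D :
    (forall u v : 'I_n, v < u -> M u v = 0) ->
    (forall u v : 'I_n, v < u -> M' u v = 0) ->
  jordan_degree_type_of M D -> jordan_degree_type_of M' D -> M = M'.
Proof.
move=> upM upM' [DM _] [DM' _].
have eqMM m u v : u + (n - v) <= m -> u <= v -> entry M u v = entry M' u v.
  elim: m u v => [|m IHm] u v le_m le_uv.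
    by rewrite !entry_out //; lia.
  have [le_nv|lt_v] := leqP n v; first by rewrite !entry_out ?le_nv ?orbT.
  have IHv : entry M u v.+1 = entry M' u v.+1 by apply: IHm; lia.
  have uv : u <= v < n by rewrite le_uv.
  have := DM u v uv; rewrite (DM' u v uv) IHv.
  case: u le_m le_uv uv IHv => [|u] le_m le_uv uv _ /=; first by lia.
  have -> : entry M u v = entry M' u v by apply: IHm; lia.
  have -> : entry M u v.+1 = entry M' u v.+1 by apply: IHm; lia.
  lia.
apply/matrixP => u v; have [le_uv|lt_vu] := leqP u v; last by rewrite upM ?upM'.
by rewrite -!entry_ord; apply: eqMM (leqnn _) le_uv.
Qed.

End JordanDegreeType.

Lemma potential_multiplicity_ge0 (K : fieldType) T (M : 'M[nat]_(size T)) u v :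
  potential_rank_matrix K M -> u <= v < size T -> (0 <= multiplicity M u v)%R.
Proof.
move=> potM /andP[le_uv lt_v]; rewrite /multiplicity.
have [lt_Sv|le_Sv] := ltnP v.+1 (size T).
  case: u le_uv => [|u] lt_uv /=.
    by have := prm_rows potM lt_uv lt_Sv; lia.
  by have := prm_squares potM lt_uv lt_Sv; lia.
rewrite [entry M u v.+1]entry_out ?le_Sv ?orbT //.
case: u le_uv => [|u] lt_uv /=; first by lia.
rewrite [entry M u v.+1]entry_out ?le_Sv ?orbT //.
by have := prm_columns potM lt_uv lt_v; lia.
Qed.

Theorem potential_rank_matrices_T34 (K : fieldType) k : 3 <= k ->
  has_exactly 26 (@potential_rank_matrix K (T34 k)).
Proof.
move=> k3; pose n := size (T34 k); have Dn : n = k + 4 := size_T34 k3.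
pose mx l := @chain_matrix n (nth [::] (T_profile :: l)).
have j_gt0 : 0 < k + 3 by lia.
have mxK : {in all_chains (k + 3), cancel mx
    (fun M => mkseq (fun i => matrix_profile M i.+1) (k + 3))}.
  move=> l /(mem_all_chains _ j_gt0)[size_l chain_l].
  apply: (@eq_from_nth _ [::]); rewrite size_mkseq ?size_l // => i lt_i.
  rewrite nth_mkseq // matrix_profile_chain_matrix //; first by lia.
  have -> : n.-1 = k + 3 by lia.
  by apply: (chain_profiles _ chain_l); lia.
exists [seq mx l | l <- all_chains (k + 3)]; split.
- by rewrite map_inj_in_uniq ?uniq_all_chains //; apply: can_in_inj mxK.
- by rewrite size_map size_all_chains //; lia.
move=> M; split=> [/mapP[l /(mem_all_chains _ j_gt0)[_ chain_l] ->]|potM].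
  exact: potential_chain_matrix.
pose l := mkseq (fun i => matrix_profile M i.+1) (k + 3).
have chain_M := matrix_profile_chain k3 potM.
have El i : i < n -> nth [::] (T_profile :: l) i = matrix_profile M i.
  case: i => [|i] lt_i; first by case: chain_M.
  by rewrite /= nth_mkseq //; lia.
apply/mapP; exists l; last by rewrite /mx (chain_matrix_of_profiles k3 potM El).
apply/(mem_all_chains _ j_gt0); split; first by rewrite size_mkseq.
case: chain_M => M0 M1 succM convM.
split=> [||i lt_i|i lt_i]; rewrite ?El //; try lia.
- exact: succM.
- exact: convM.
Qed.

Theorem theorem3p5 (K : fieldType) (k : nat) :
  infinite_type K -> (3 <= k)%N ->
  has_exactly 26 (@potential_jordan_degree_type K (T34 k)) /\
  has_exactly 26 (@potential_rank_matrix K (T34 k)).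
Proof.
move=> _ k3; have matrices := potential_rank_matrices_T34 K k3.
split=> //; case: matrices => s [uniq_s size_s sP].
have typeP (M : 'M[nat]_(size (T34 k))) :
    potential_rank_matrix K M -> jordan_degree_type_of M (jordan_type M).
  move=> potM; apply: jordan_typeP => u v.
  exact: potential_multiplicity_ge0 potM.
exists [seq jordan_type M | M <- s]; split; rewrite ?size_map //.
  rewrite map_inj_in_uniq // => M M' /sP potM /sP potM' eqJ.
  have JM' := typeP M' potM'; rewrite -eqJ in JM'.
  have [upM upM'] := (prm_upper potM, prm_upper potM').
  exact: jordan_degree_type_inj upM upM' (typeP M potM) JM'.
move=> D; split=> [/mapP[M /sP potM ->]|[M potM DM]].
  by exists M => //; apply: typeP.
apply/mapP; exists M; first exact/sP.
exact: jordan_degree_type_unique DM (typeP M potM).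
Qed.
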